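(* Let $d\to\infty$ and let $k=k(d)\in\mathbb{N}$ be a function of $d$ such that $\lim_{d\to\infty}k(d)=\infty$ and $\lim_{d\to\infty}\frac{k(d)}{d}=0$. If an integer sequence $n=n(d)$ is such that $d<n(d)\leq k\,e^{(1-\varepsilon)d/k}$ for some $\varepsilon>0$ and all sufficiently large $d$, then $$\lim_{d\to\infty}\frac{\mathbb{E}f_{k-1}(C_{n-1,d})}{\binom nk}=1.$$ On the other hand, if $n(d)\geq k\,e^{(1+\varepsilon)d/k}$ for some $\varepsilon>0$ and all sufficiently large $d$, then $$\lim_{d\to\infty}\frac{\mathbb{E}f_{k-1}(C_{n-1,d})}{\binom nk}=0.$$
   Context: For each (sufficiently large) $d$, let $\xi_1,\ldots,\xi_{n-1}$ (with $n=n(d)$, $n-1\geq d$) be random vectors in $\mathbb{R}^d$ (possibly dependent, with joint law allowed to depend on $d$), and let $S_0=0$, $S_i=\xi_1+\cdots+\xi_i$, $1\leq i\leq n-1$. Standing assumptions: (Exchangeability) for every permutation $\sigma$ of $\{1,\ldots,n-1\}$, $(\xi_{\sigma(1)},\ldots,\xi_{\sigma(n-1)})$ has the same distribution as $(\xi_1,\ldots,\xi_{n-1})$; (General position) for every $1\leq i_1<\cdots<i_d\leq n-1$ the probability that $S_{i_1},\ldots,S_{i_d}$ are linearly dependent is $0$. Let $C_{n-1,d}:=\operatorname{conv}(S_0,S_1,\ldots,S_{n-1})\subset\mathbb{R}^d$, the convex hull of $n$ points, and let $f_\ell(C_{n-1,d})$ be the number of $\ell$-dimensional faces of this polytope. 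*)

(* Defs.v *)
From mathcomp Require Export all_boot all_order all_fingroup all_algebra.
From mathcomp Require Export finmap.
From mathcomp Require Export all_classical all_reals all_analysis.
Set Implicit Arguments.
Unset Strict Implicit.
Unset Printing Implicit Defensive.
Import Order.TTheory GRing.Theory Num.Theory.
Export numFieldNormedType.Exports.
Local Open Scope classical_set_scope.
Local Open Scope ring_scope.

(* R^d with its Borel sigma-algebra; convertible to ['rV[R]_d]. *)
Notation borel_rV R d := (g_sigma_algebraType (@open 'rV[R]_d)).

Section RandomWalk.
Variables (R : realType) (disp : measure_display) (T : measurableType disp).
Variables (P : probability T R) (d m : nat).
Variable xi : 'I_m -> {RV P >-> borel_rV R d}.

(* The index ['I_m] is 0-based: [xi j] is the increment xi_(j+1). *)
Definition walk (w : T) (i : nat) : 'rV[R]_d :=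
  \sum_(j < m | (j < i)%N) (xi j w : 'rV[R]_d).

(* Equality of joint laws on the product sigma-algebra of (R^d)^m. *)
Definition exchangeable : Prop :=
  forall (s : {perm 'I_m}) (A : set (m.-tuple (borel_rV R d))),
    measurable A ->
    pushforward P (fun w => [tuple xi (s i) w | i < m]) A =
    pushforward P (fun w => [tuple xi i w | i < m]) A.

Definition general_position : Prop :=
  forall t : 'I_d -> nat,
    (forall a, (0 < t a <= m)%N) -> {homo t : a b / (a < b)%N} ->
    P [set w | ~~ free [tuple walk w (t a) | a < d]] = 0%E.

Definition walk_hull (w : T) : set 'rV[R]_d :=
  smallest (@convex_set R 'rV[R]_d) [set walk w i | i in `I_m.+1].

End RandomWalk.

Section Faces.
Variables (R : realType) (d : nat).
Implicit Types C F : set 'rV[R]_d.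

(* The choice c = 0 makes C itself (b = 0) and the empty set (b = 1) faces;
   the latter has no dimension in the sense of [affine_dim] below. *)
Definition face C F : Prop :=
  exists (c : 'cV[R]_d) (b : R),
    (forall x, C x -> (x *m c) 0 0 <= b) /\
    F = C `&` [set x | (x *m c) 0 0 = b].

(* The affine hull of F is x0 + U. *)
Definition affine_dim F (l : nat) : Prop :=
  exists x0 : 'rV[R]_d, F x0 /\
  exists U : {vspace 'rV[R]_d}, \dim U = l /\
    (forall x, F x -> x - x0 \in U) /\
    (forall V : {vspace 'rV[R]_d},
       (forall x, F x -> x - x0 \in V) -> (U <= V)%VS).

(* [fset_set] is only meaningful on finite sets; polytopes have finitely many
   faces. *)
Definition nfaces (l : nat) C : nat :=
  #|` fset_set [set F | face C F /\ affine_dim F l]|.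

End Faces.

(* Main.v *)
Require Import Defs.
From HB Require Import structures.
From mathcomp Require Import measurable_realfun.
From mathcomp Require Import zify ring lra.

(** Write [n] for the number of points of the walk and [S_p] for the points,
    [0 <= p < n], read cyclically, so that the increment at [p] is
    [y_p = S_p - S_(p-1)] and the increments sum to zero. In general position
    the hull is simplicial below dimension [d], and its faces of dimension
    [k - 1] are the [k]-sets [I] of indices exposed by some linear functional
    ([nfaces_exposed]). By Gordan's alternative, [I] is not exposed exactly when
    some relation [sum_p a_p y_p = 0] is strictly decreasing in the cyclic order
    after every index except those of [I] ([exposed_iff], [descent_iff]).

    By exchangeability, the expected number of non-faces is the average, over
    all orders of the steps, of the number of pairs (order, [I]) admitting such a
    relation ([expected_faces]); this deterministic count is bounded uniformly
    over the steps in general position. Rotating the cyclic order so that a mark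
    of [I] comes last ([sum_rotations]), [I] splits the positions into [k] linear
    blocks, and one counts the orders of the blocks realized by a vector of the space of
    relations, of dimension [n - d]: these are the regions of a product of braid
    arrangements cut by that space. Inserting the entries one at a time
    (deletion and restriction, [nregions_insert]) gives a recursion for their
    number, which is the recursion for the coefficients of the product over the
    blocks of [t (t + 1) ... (t + m - 1)]. Tilting by a power of [t] given by the
    dimension turns the recursion directly into the bounds
    [nregions_le] ([t >= 1], for the realized orders) and [nregions_ge]
    ([t <= 1], for the others).

    Dividing by the number of all orders, the proportion of non-faces is at most
    [t ^ -d] times an average over [I] of the products of the weights
    [t (t + 1) ... (t + m - 1) / m!] of the block sizes, for [t >= 1], and the
    proportion of faces at most [t ^ -(d + 1)] times the same average, for
    [t <= 1]. Such a weight behaves like [m ^ (t - 1)]. With [t = 1 + delta] the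
    product is at most [(e n / k) ^ (delta k)] for every [I], and the bound tends
    to 0 when [k ln (n / k) <= (1 - eps) d]. With [t = 1 - delta] the average over
    [I] is computed by a geometric weighting of the block sizes
    ([sum_block_product_le]); it is about [(n / k) ^ (- delta k)], and the bound
    tends to 0 when [k ln (n / k) >= (1 + eps) d]. *)

Set Implicit Arguments.
Unset Strict Implicit.
Unset Printing Implicit Defensive.
Import Order.TTheory GRing.Theory Num.Theory.
Local Open Scope ring_scope.

(** * Sign patterns of linear forms on a subspace *)

Fixpoint bitseqs (m : nat) : seq bitseq :=
  if m is m'.+1 then map (cons true) (bitseqs m') ++ map (cons false) (bitseqs m')
  else [:: [::]].

Lemma mem_bitseqs m (b : bitseq) : (b \in bitseqs m) = (size b == m).
Proof.
elim: m b => [|m IH] [|c b] //=.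
  by rewrite mem_cat; apply/negbTE/norP; split; apply/mapP; case.
rewrite mem_cat eqSS -IH; case: c.
  rewrite mem_map; last by move=> ? ? [].
  by rewrite orbC; case: mapP => //; case.
rewrite (mem_map (f := cons false)); last by move=> ? ? [].
by case: mapP => //; case.
Qed.

Lemma uniq_bitseqs m : uniq (bitseqs m).
Proof.
elim: m => //= m IH.
rewrite cat_uniq !map_inj_uniq ?IH; do ?by move=> ? ? [].
rewrite /= andbT; apply/hasPn => _ /mapP[b _ ->].
by apply/mapP; case.
Qed.

Section SignPatterns.
Variables (R : realFieldType) (U : vectType R).
Implicit Types (E F : seq 'Hom(U, R^o)) (V : {vspace U}) (f g : 'Hom(U, R^o)).

Definition realizes E V (b : bitseq) : Prop :=
  exists u, [/\ u \in V, all (fun f => f u != 0) E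
                & map (fun f => (0 : R) < f u) E = b].

(** The regions of the hyperplane arrangement cut out by [E] on [V], each
    encoded by its vector of strict signs. *)
Definition nregions E V : nat :=
  \sum_(b <- bitseqs (size E)) `[< realizes E V b >].

Lemma nregions_cons f E V :
  nregions (f :: E) V =
  (\sum_(b <- bitseqs (size E))
    (`[< realizes (f :: E) V (true :: b) >] + `[< realizes (f :: E) V (false :: b) >]))%N.
Proof. by rewrite /nregions /= big_cat !big_map big_split. Qed.

Lemma realizes_cons f E V c b :
  realizes (f :: E) V (c :: b) <->
  exists u, [/\ u \in V, all (fun f => f u != 0) E,
     map (fun f => (0 : R) < f u) E = b, f u != 0 & ((0 : R) < f u) = c].
Proof.
split=> [[u [uV /= /andP[f0 E0] [hc hb]]]|[u [uV E0 hb f0 hc]]].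
  by exists u.
by exists u; rewrite /= f0 E0 hc hb.
Qed.

(** Used to leave a hyperplane without leaving a region. *)
Lemma signs_perturb E u v :
  all (fun f => f u != 0) E -> exists2 e : R, 0 < e &
  forall r, `|r| <= e ->
    all (fun f => f (u + r *: v) != 0) E /\
    map (fun f => (0 : R) < f (u + r *: v)) E = map (fun f => (0 : R) < f u) E.
Proof.
elim: E => [|f E IH] /=; first by move=> _; exists 1.
case/andP=> f0 /IH[e e0 he].
have fu0 : 0 < `|f u| by rewrite normr_gt0.
exists (Num.min e (`|f u| / (2 * (`|f v| + 1)))).
  rewrite lt_min e0 /= divr_gt0 // mulr_gt0 // ltr_wpDl //.
move=> r; rewrite le_min => /andP[/he[-> ->]].
have D0 : 0 < 2 * (`|f v : R| + 1) by rewrite mulr_gt0 // ltr_wpDl.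
rewrite ler_pdivlMr // => hr.
rewrite linearD linearZ /= andbT.
have small : `|(r *: f v : R)| < `|f u|.
  have -> : (r *: f v : R) = r * f v by [].
  rewrite normrM; have : 0 <= `|r| * `|f v : R| by rewrite mulr_ge0.
  have : 0 <= `|r| by [].
  have [->|/eqP r0] := eqVneq r 0; first by rewrite normr0 mul0r.
  have : 0 < `|r| by rewrite normr_gt0; apply/eqP.
  by move: hr; rewrite mulrCA mulrDr mulr1; lra.
move: small f0; rewrite ltr_norml; set a : R := r *: f v; set b : R := f u.
case: (ltrgt0P b) => // hb /andP[h1 h2] _.
  have -> : (0 < b + a) = true by lra.
  by split => //; apply: lt0r_neq0; lra.
have -> : (0 < b + a) = false by apply/negbTE; rewrite -leNgt; lra.
by split => //; apply: ltr0_neq0; lra.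
Qed.

Lemma realizes_capS E V W b : (W <= V)%VS -> realizes E W b -> realizes E V b.
Proof. by move=> /subvP sWV [u [uW E0 hb]]; exists u; split; rewrite ?sWV. Qed.

Lemma nregions0 f E V : f \in E -> (V <= lker f)%VS -> nregions E V = 0%N.
Proof.
move=> fE /subvP Vf; rewrite /nregions big1 // => b _.
case: asboolP => // -[u [/Vf + /allP /(_ f fE)]].
by rewrite memv_ker => ->.
Qed.

(** Deletion and restriction: a region of the smaller arrangement is cut into
    two by the hyperplane [f = 0] exactly when it meets that hyperplane. *)
Lemma nregions_delres f E V : ~~ (V <= lker f)%VS ->
  nregions (f :: E) V = (nregions E V + nregions E (V :&: lker f)%VS)%N.
Proof.
move=> /subvPn[v vV]; rewrite memv_ker => fv0.
rewrite nregions_cons /nregions -big_split /=; apply: eq_bigr => b _.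
set t := asbool (realizes _ _ (true :: b)).
set s := asbool (realizes _ _ (false :: b)).
have -> : `[< realizes E V b >] = t || s.
  apply/asboolP/orP => [[u [uV E0 hb]]|]; last first.
    by case=> /asboolP /realizes_cons[u [uV E0 hb _ _]]; exists u.
  (* An open region is not contained in the hyperplane: leave it along [v]. *)
  have [fu0|fu0] := eqVneq (f u) 0; last first.
    case fs: ((0 : R) < f u); [left|right];
      by apply/asboolP/realizes_cons; exists u.
  have [e e0 he] := signs_perturb v E0.
  have [h1 h2] := he e (eq_ind_r (fun z => z <= e) (lexx e) (gtr0_norm e0)).
  have h3 : f (u + e *: v) != 0.
    rewrite linearD linearZ /= fu0 add0r.
    by rewrite (_ : e *: f v = e * (f v : R)) // mulf_neq0 // gt_eqF.
  have h4 : u + e *: v \in V by rewrite memvD // memvZ.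
  case fs: ((0 : R) < f (u + e *: v)); [left|right];
      by apply/asboolP/realizes_cons; exists (u + e *: v); rewrite h2.
have -> : `[< realizes E (V :&: lker f)%VS b >] = t && s.
  apply/asboolP/andP => [[u [/memv_capP[uV]]]|[]].
    rewrite memv_ker => /eqP fu0 E0 hb.
    have [e e0 he] := signs_perturb v E0.
    have key r : `|r| <= e -> r != 0 -> realizes (f :: E) V ((0 < r * f v) :: b).
      move=> hr r0; have [h1 h2] := he r hr; apply/realizes_cons.
      exists (u + r *: v); rewrite h2; split=> //.
      - by rewrite memvD // memvZ.
      - rewrite linearD linearZ /= fu0 add0r.
        by rewrite (_ : r *: f v = r * (f v : R)) // mulf_neq0.
      - by rewrite linearD linearZ /= fu0 add0r.
    have ke := key e (eq_ind_r (fun z => z <= e) (lexx e) (gtr0_norm e0)) (lt0r_neq0 e0).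
    have kN : realizes (f :: E) V ((0 < - e * f v) :: b).
      by apply: key; rewrite ?normrN ?gtr0_norm // oppr_eq0 gt_eqF.
    move: ke kN; rewrite mulNr oppr_gt0; have : e * f v != 0.
      by rewrite mulf_neq0 // gt_eqF.
    by case: ltrgt0P => // _ _ h1 h2; split; apply/asboolP.
  move=> /asboolP /realizes_cons[u [uV uE ub u0 us]].
  move=> /asboolP /realizes_cons[w [wV wE wb w0 ws]].
  have fu : (0 : R) < f u by rewrite us.
  have fw : (f w : R) < 0 by rewrite lt_neqAle w0 leNgt ws.
  (* The point where the segment from [u] to [w] crosses the hyperplane, up
     to a positive factor. *)
  pose z := (- f w : R) *: u + (f u : R) *: w.
  have signs g : g \in E -> g z != 0 /\ ((0 : R) < g z) = (0 < (g u : R)).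
    move=> gE; have gu := allP uE g gE; have gw := allP wE g gE.
    have : (0 < (g u : R)) = (0 < (g w : R)).
      by move: ub; rewrite -wb => /eq_in_map /(_ g gE).
    rewrite /z linearD !linearZ /=.
    set a : R := g u in gu *; set c : R := g w in gw *.
    have -> : ((- f w : R) *: g u + (f u : R) *: g w) = (- (f w : R)) * a + (f u : R) * c by [].
    set p : R := f u in fu *; set q : R := f w in fw *.
    case: (ltrgt0P a) gu => // ha _; case: (ltrgt0P c) gw => // hc _ // _.
      have h : 0 < (- q) * a + p * c by rewrite addr_gt0 // mulr_gt0 // oppr_gt0.
      by rewrite h gt_eqF.
    have h : (- q) * a + p * c < 0.
      by rewrite -oppr_gt0 opprD addr_gt0 // -mulrN mulr_gt0 // oppr_gt0.
    by rewrite lt_eqF // ltNge ltW.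
  exists z; split.
  - rewrite memv_cap memv_ker memvD ?memvZ //=.
    rewrite /z linearD !linearZ /=.
    have -> : ((- f w : R) *: f u + (f u : R) *: f w) = (- (f w : R)) * (f u : R) + (f u : R) * (f w : R) by [].
    by rewrite mulNr mulrC addNr.
  - by apply/allP => g /signs[].
  - by rewrite -ub; apply/eq_in_map => g /signs[].
by case: t; case: s.
Qed.

(** The sign of [f] on [V] is determined by that of [g]. *)
Lemma nregions_redundant f g E V : g \in E ->
  (V <= lker (f - g)%R)%VS \/ (V <= lker (f + g)%R)%VS ->
  nregions (f :: E) V = nregions E V.
Proof.
move=> gE fg.
have fgV u : u \in V -> f u = g u \/ f u = - g u.
  case: fg => /subvP h /h; rewrite memv_ker lfunE /=.
    by rewrite lfunE /= subr_eq0 => /eqP ->; left.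
  by rewrite addr_eq0 => /eqP ->; right.
rewrite nregions_cons /nregions; apply: eq_bigr => b _.
set t := asbool (realizes _ _ (true :: b)).
set s := asbool (realizes _ _ (false :: b)).
have -> : `[< realizes E V b >] = t || s.
  apply/asboolP/orP => [[u [uV E0 hb]]|]; last first.
    by case=> /asboolP /realizes_cons[u [uV E0 hb _ _]]; exists u.
  have fu0 : f u != 0.
    have := allP E0 g gE; case: (fgV u uV) => -> //.
    by rewrite oppr_eq0.
  case fs: ((0 : R) < f u); [left|right];
      by apply/asboolP/realizes_cons; exists u.
suff : ~~ (t && s) by case: t; case: s.
apply/negP => /andP[].
move=> /asboolP /realizes_cons[u [uV uE ub u0 us]].
move=> /asboolP /realizes_cons[w [wV wE wb w0 ws]].
have : (0 < (g u : R)) = (0 < (g w : R)).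
  by move: ub; rewrite -wb => /eq_in_map /(_ g gE).
have gu := allP uE g gE; have gw := allP wE g gE.
have fgs : (forall v, v \in V -> f v = g v) \/ (forall v, v \in V -> f v = - g v).
  case: fg => /subvP h; [left|right] => v /h; rewrite memv_ker lfunE /=.
    by rewrite lfunE /= subr_eq0 => /eqP.
  by rewrite addr_eq0 => /eqP.
move: us ws; case: fgs => h; rewrite !h // ?oppr_gt0 => h1 h2; rewrite ?h1 ?h2 //.
move: gu gw h1 h2; set x : R := g u; set y : R := g w.
by case: (ltrgt0P x); case: (ltrgt0P y).
Qed.

End SignPatterns.

(** * Braid arrangements on the blocks of a partition *)

Section BraidRegions.
Variables (R : realFieldType) (n : nat) (K : eqType) (beta : 'I_n -> K).
Implicit Types (V : {vspace 'rV[R]_n}) (s l : seq 'I_n) (i j e : 'I_n).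

Definition entry i (a : 'rV[R]_n) : R^o := a 0 i.
Fact entry_is_linear i : linear (entry i).
Proof. by move=> c a b; rewrite /entry !mxE. Qed.
HB.instance Definition _ i :=
  GRing.isLinear.Build R 'rV[R]_n R^o *:%R (entry i) (entry_is_linear i).

Definition gap i j : 'Hom('rV[R]_n, R^o) := linfun (entry i) - linfun (entry j).

Lemma gapE i j a : gap i j a = a 0 i - a 0 j.
Proof. by rewrite /gap add_lfunE opp_lfunE !lfunE. Qed.

(** Comparing every element with the later members of its block, so that the
    arrangement grows by the insertion of one element at a time. *)
Fixpoint block_gaps s : seq 'Hom('rV[R]_n, R^o) :=
  if s is e :: s' then
    [seq gap i e | i <- s' & beta i == beta e] ++ block_gaps s'
  else [::].

(** The product over the blocks of [t (t + 1) ... (t + m - 1)], [m] being the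
    block size, in the form of the recursion for [nregions]. *)
Fixpoint block_weight (t : R) s : R :=
  if s is e :: s' then
    (t + (count (fun i => beta i == beta e) s')%:R) * block_weight t s'
  else 1.

Lemma mem_block_gaps s i j :
  i \in s -> j \in s -> i != j -> beta i = beta j ->
  gap i j \in block_gaps s \/ gap j i \in block_gaps s.
Proof.
elim: s => //= e s IH; rewrite !inE => /predU1P[->|iS] /predU1P[->|jS] ij bij.
- by rewrite eqxx in ij.
- right; rewrite mem_cat; apply/orP; left; apply/mapP; exists j => //.
  by rewrite mem_filter bij eqxx.
- left; rewrite mem_cat; apply/orP; left; apply/mapP; exists i => //.
  by rewrite mem_filter bij eqxx.
by case: (IH iS jS ij bij) => h; [left|right]; rewrite mem_cat h orbT.
Qed.

(** On the hyperplane where the entries [i] and [e] agree, the differences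
    with [e] repeat those with [i], so that they cut nothing. *)
Lemma nregions_merge e i s l V :
  i \in s -> i \notin l -> beta i = beta e ->
  {in l, forall j, j \in s /\ beta j = beta e} ->
  nregions ([seq gap j e | j <- l] ++ block_gaps s) (V :&: lker (gap i e))%VS =
  nregions (block_gaps s) (V :&: lker (gap i e))%VS.
Proof.
move=> iS + bi; elim: l => //= j l IH; rewrite inE negb_or => /andP[ij il] hl.
have hl' : {in l, forall j, j \in s /\ beta j = beta e}.
  by move=> x xl; apply: hl; rewrite inE xl orbT.
rewrite -(IH il hl').
have [js bj] := hl j (mem_head _ _).
have [|h|h] := mem_block_gaps js iS _ (etrans bj (esym bi)).
- by rewrite eq_sym.
- apply: (@nregions_redundant _ _ _ (gap j i)); first by rewrite mem_cat h orbT.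
  left; apply/subvP => u; rewrite memv_cap => /andP[_].
  rewrite !memv_ker gapE => /eqP hu; rewrite add_lfunE opp_lfunE !gapE.
  by apply/eqP; move: hu; set x := u 0 i; set y := u 0 e; set z := u 0 j; lra.
- apply: (@nregions_redundant _ _ _ (gap i j)); first by rewrite mem_cat h orbT.
  right; apply/subvP => u; rewrite memv_cap => /andP[_].
  rewrite !memv_ker gapE => /eqP hu; rewrite add_lfunE !gapE.
  by apply/eqP; move: hu; set x := u 0 i; set y := u 0 e; set z := u 0 j; lra.
Qed.

(** Inserting [e] into the arrangement: the old regions survive, and each
    hyperplane [a_i = a_e] adds the regions of the arrangement in which [e]
    is identified with [i]. *)
Lemma nregions_insert e s V : uniq s ->
  (forall i, i \in s -> beta i = beta e -> ~~ (V <= lker (gap i e))%VS) ->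
  nregions (block_gaps (e :: s)) V =
  (nregions (block_gaps s) V +
   \sum_(i <- s | beta i == beta e) nregions (block_gaps s) (V :&: lker (gap i e))%VS)%N.
Proof.
move=> us hV; rewrite /= -big_filter.
have : {in [seq i <- s | beta i == beta e], forall j, j \in s /\ beta j = beta e}.
  by move=> j; rewrite mem_filter => /andP[/eqP].
have := filter_uniq (fun i => beta i == beta e) us.
elim: [seq _ <- _ | _] => [|i l IH] /=; first by rewrite big_nil addn0.
move=> /andP[il ul] hl.
have hl' : {in l, forall j, j \in s /\ beta j = beta e}.
  by move=> x xl; apply: hl; rewrite inE xl orbT.
have [iS bi] := hl i (mem_head _ _).
rewrite nregions_delres ?hV // IH // big_cons nregions_merge //.
by rewrite -!addnA [(_ + nregions _ (V :&: _)%VS)%N]addnC.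
Qed.

Lemma block_weight_gt0 t s : 0 < t -> 0 < block_weight t s.
Proof. by move=> t0; elim: s => //= e s IH; rewrite mulr_gt0 // ltr_wpDr. Qed.

(** Tilting by [t ^ (|s| - dim V)] turns the recursion of [nregions_insert] into
    that of [block_weight]: deleting [e] changes the exponent by one and
    contributes [t], identifying [e] with another entry does not and contributes
    1. A hyperplane that contains [V] leaves no region at all, and a dimension
    smaller than expected only lowers the bound when [t >= 1]. *)
Lemma nregions_le t s V : 1 <= t -> uniq s ->
  (nregions (block_gaps s) V)%:R * t ^+ size s <= t ^+ \dim V * block_weight t s.
Proof.
move=> t1; have t0 : 0 < t by apply: lt_le_trans t1.
elim: s V => [|e s IH] V /=.
  rewrite /nregions /= big_cons big_nil addn0 mulr1 => _.
  apply: (@le_trans _ _ 1); first by rewrite (ler_nat _ _ 1); case: asbool.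
  by rewrite mulr1 exprn_ege1.
move=> /andP[es us].
have [/hasP[i iS /andP[bi Vi]]|/hasPn h] :=
    boolP (has (fun i => (beta i == beta e) && (V <= lker (gap i e))%VS) s).
  rewrite (@nregions0 _ _ (gap i e)) //; last first.
    by rewrite mem_cat; apply/orP; left; apply/map_f; rewrite mem_filter bi.
  by rewrite mul0r mulr_ge0 ?exprn_ge0 ?mulr_ge0 ?ltW // ?block_weight_gt0 // ltr_wpDr.
have hV i : i \in s -> beta i = beta e -> ~~ (V <= lker (gap i e))%VS.
  by move=> /h /[swap] ->; rewrite eqxx.
rewrite (@nregions_insert e) // natrD natr_sum mulrDl exprS mulrCA.
rewrite mulrDl mulrDr [X in _ <= X + _]mulrCA.
apply: lerD; first by rewrite ler_pM2l // IH.
rewrite -sum1_count natr_sum mulr_suml mulr_suml mulr_sumr.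
rewrite big_seq_cond [X in _ <= X]big_seq_cond; apply: ler_sum => i /andP[iS /eqP bi].
rewrite mul1r mulrCA.
apply: (@le_trans _ _ (t * (t ^+ \dim (V :&: lker (gap i e)) * block_weight t s))).
  by rewrite ler_pM2l // IH.
rewrite mulrA -exprS ler_pM2r ?block_weight_gt0 // ler_weXn2l //.
rewrite ltnNge; apply: contra (hV i iS bi).
by rewrite (geq_leqif (dimv_leqif_sup (capvSl _ _))) subv_cap subvv.
Qed.

(** No hyperplane contains any of the subspaces met along the insertion, as
    long as their nominal dimension is positive; [D] is the nominal dimension
    of [V]. *)
Fixpoint gen_pos D s V : Prop :=
  match s, D with
  | e :: s', D'.+1 => gen_pos D s' V /\
      forall i, i \in s' -> beta i = beta e ->
        ~~ (V <= lker (gap i e))%VS /\ gen_pos D' s' (V :&: lker (gap i e))%VS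
  | _, _ => True
  end.

(** The same induction for the orders that are not realized. At nominal
    dimension 0 the bound holds for every subspace, since
    [t (1 + c) <= t + c]. *)
Lemma nregions_ge D t s V : 0 < t <= 1 -> uniq s -> gen_pos D s V ->
  (block_weight 1 s - (nregions (block_gaps s) V)%:R) * t ^+ size s
    <= t ^+ D * block_weight t s.
Proof.
move=> /andP[t0 t1].
have triv W s' : (block_weight 1 s' - (nregions (block_gaps s') W)%:R) * t ^+ size s'
    <= block_weight t s'.
  apply: (@le_trans _ _ (block_weight 1 s' * t ^+ size s')).
    by rewrite ler_pM2r ?exprn_gt0 // gerBl.
  elim: s' => [|e s' IH]; first by rewrite mulr1.
  rewrite /= exprS mulrACA; apply: ler_pM => //.
  - by rewrite mulr_ge0 ?ltW // ltr_wpDr.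
  - by rewrite mulr_ge0 ?exprn_ge0 ?ltW // block_weight_gt0.
  - rewrite mulrDl mul1r lerD2l -[leRHS]mulr1; apply: ler_wpM2l => //.
elim: s D V => [|e s IH] D V us hg.
  rewrite /= /nregions /= big_cons big_nil addn0 !mulr1.
  case: asboolP => [_|[]]; first by rewrite subrr exprn_ge0 // ltW.
  by exists 0; rewrite mem0v.
case: D hg => [|D] hg; first by rewrite expr0 mul1r triv.
case: hg => hg1 hg2; move: us => /= /andP[es us].
rewrite (@nregions_insert e) // => [|i iS bi]; last by case: (hg2 i iS bi).
have -> : (1 + (count (fun i => beta i == beta e) s)%:R) * block_weight 1 s -
   (nregions (block_gaps s) V + \sum_(i <- s | beta i == beta e)
     nregions (block_gaps s) (V :&: lker (gap i e))%VS)%:R =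
   (block_weight 1 s - (nregions (block_gaps s) V)%:R) +
   \sum_(i <- s | beta i == beta e)
     (block_weight 1 s - (nregions (block_gaps s) (V :&: lker (gap i e))%VS)%:R).
  rewrite sumrB natrD natr_sum big_const_seq iter_addr_0 mulrDl mul1r mulr_natl.
  by ring.
rewrite mulrDl (exprS t (size s)) (mulrDl t) mulrDr.
rewrite [X in _ <= X + _]mulrCA [X in X + _ <= _]mulrCA.
apply: lerD; first by rewrite ler_pM2l // IH.
rewrite -sum1_count natr_sum mulr_suml mulr_suml mulr_sumr.
rewrite big_seq_cond [X in _ <= X]big_seq_cond; apply: ler_sum => i /andP[iS /eqP bi].
rewrite mul1r mulrCA (exprS t D). rewrite -[leRHS]mulrA ler_pM2l // IH //.
by case: (hg2 i iS bi).
Qed.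

Lemma block_gaps_neq s f e (a a' : 'rV[R]_n) : e \notin s ->
  (forall i, i != e -> a 0 i = a' 0 i) -> f \in block_gaps s -> f a = f a'.
Proof.
move=> + haa; elim: s => //= j s IH; rewrite inE negb_or => /andP[ej es].
rewrite mem_cat => /orP[/mapP[i]|/(IH es)//].
rewrite mem_filter => /andP[_ iS] ->; rewrite !gapE !haa //; first by rewrite eq_sym.
by apply: contraNneq es => <-.
Qed.

(** On the whole space an entry may be moved onto another one, so that the
    identification of two entries costs nothing. *)
Lemma nregions_full s : uniq s ->
  (nregions (block_gaps s) fullv)%:R = block_weight 1 s.
Proof.
elim: s => [_|e s IH /= /andP[es us]].
  rewrite /nregions /= big_cons big_nil addn0.
  by case: asboolP => // -[]; exists 0; rewrite memvf.
rewrite (@nregions_insert e) // => [|i iS _]; last first.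
  apply/subvPn; exists (delta_mx 0 i); first by rewrite memvf.
  rewrite memv_ker gapE !mxE !eqxx /= (_ : (e == i) = false) ?subr0 ?oner_eq0 //.
  by apply: contraNF es => /eqP ->.
have same i : i \in s -> nregions (block_gaps s) (fullv :&: lker (gap i e))%VS =
    nregions (block_gaps s) fullv.
  move=> iS; apply: eq_bigr => b _; congr (nat_of_bool _); apply/asboolP/asboolP.
    by apply: realizes_capS; apply: capvSl.
  move=> [u [_ E0 hb]].
  pose u' : 'rV[R]_n := \row_j u 0 (if j == e then i else j).
  have uu' f : f \in block_gaps s -> f u' = f u.
    by apply: (block_gaps_neq es) => j /negbTE je; rewrite !mxE je.
  exists u'; split.
  - rewrite memv_cap memvf memv_ker gapE !mxE eqxx.
    by rewrite /= if_same subrr.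
  - by apply/allP => f fE; rewrite uu' // (allP E0).
  - by rewrite -hb; apply/eq_in_map => f fE; rewrite uu'.
rewrite natrD natr_sum big_seq_cond (eq_bigr (fun=> block_weight 1 s)); last first.
  by move=> i /andP[iS _]; rewrite same // IH.
rewrite -big_seq_cond big_const_seq iter_addr_0 IH // mulrDl mul1r mulr_natl //.
Qed.

Definition block_perm (w : {perm 'I_n}) := [forall p, beta (w p) == beta p].

(** Rearrangement: among the permutations preserving the blocks, one that
    maximizes [- sum_p p a_(w p)] sorts [a] inside every block, since a
    transposition would otherwise increase the sum. *)
Lemma block_sort (a : 'I_n -> R) : exists2 w, block_perm w &
  forall p q, beta p = beta q -> (p < q)%N -> a (w q) <= a (w p).
Proof.
pose F (w : {perm 'I_n}) : R := \sum_(p < n) - p%:R * a (w p).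
have b1 : block_perm 1%g by apply/forallP => p; rewrite perm1.
have := @Order.TotalTheory.arg_maxP _ R _ 1%g block_perm F b1.
set w := Order.arg_max _ _ _ => -[w0 bw wmax].
exists w0 => // p q bpq pq.
have npq : p != q by rewrite -val_eqE /= ltn_eqF.
have bw' : block_perm (tperm p q * w0)%g.
  apply/forallP => r; rewrite permM (eqP (forallP bw _)).
  by case: tpermP => [->|->|_ _]; rewrite ?bpq.
have : F (tperm p q * w0)%g <= F w0 by exact: wmax.
rewrite /F.
rewrite (bigD1 p) // (bigD1 q) 1?eq_sym //= [X in _ <= X](bigD1 p) //.
rewrite [X in _ <= _ + X](bigD1 q) 1?eq_sym //= !permM tpermL tpermR.
rewrite (eq_bigr (fun i : 'I_n => - i%:R * a (w0 i))); last first.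
  by move=> i /andP[ip iq]; rewrite permM tpermD // eq_sym.
rewrite !addrA lerD2r.
have : (p%:R : R) < q%:R by rewrite ltr_nat.
set x := a (w0 p); set z := a (w0 q); set P : R := p%:R; set Q : R := q%:R.
move=> PQ h; rewrite -subr_ge0.
have : 0 <= (Q - P) * (x - z) by move: h; rewrite mulrBl !mulrBr; lra.
by rewrite pmulr_rge0 // subr_gt0.
Qed.

Definition sorts V (w : {perm 'I_n}) : Prop := exists2 a, a \in V &
  forall p q, beta p = beta q -> (p < q)%N -> a 0 (w q) < a 0 (w p).

(* Any row sorted by [w] has the same sign pattern as this one. *)
Let rank_row (w : {perm 'I_n}) : 'rV[R]_n := \row_i - ((w^-1)%g i)%:R.

Lemma block_gapsP s f : uniq s -> f \in block_gaps s ->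
  exists i e, [/\ beta i = beta e, i != e & f = gap i e].
Proof.
elim: s => //= e s IH /andP[es us]; rewrite mem_cat => /orP[/mapP[i]|/IH]; last exact.
rewrite mem_filter => /andP[/eqP bi iS] ->; exists i, e; split=> //.
by apply: contraNneq es => <-.
Qed.

Lemma sorts_sign s (w : {perm 'I_n}) (a : 'rV[R]_n) : uniq s -> block_perm w ->
  (forall p q, beta p = beta q -> (p < q)%N -> a 0 (w q) < a 0 (w p)) ->
  {in block_gaps s, forall f : 'Hom('rV[R]_n, R^o), f a != 0 /\ (0 < (f a : R)) = (0 < (f (rank_row w) : R))}.
Proof.
move=> us /forallP bw ha f /(block_gapsP us)[i [e [bie nie ->]]].
rewrite !gapE !mxE subr_eq0 opprK [- _ + _]addrC !subr_gt0 ltr_nat.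
have b' j : beta ((w^-1)%g j) = beta j by rewrite -{2}(permKV w j) (eqP (bw _)).
set p := (w^-1)%g i; set q := (w^-1)%g e.
have -> : i = w p by rewrite permKV.
have -> : e = w q by rewrite permKV.
have bpq : beta p = beta q by rewrite !b'.
have npq : p != q by apply: contraNneq nie => /perm_inj ->.
have [lt|lt|eq] := ltngtP p q; last by case/eqP: npq; apply: val_inj.
  have h := ha _ _ bpq lt; rewrite h gt_eqF //.
have h := ha _ _ (esym bpq) lt; rewrite lt_eqF //; split => //.
by apply/negbTE; rewrite -leNgt ltW.
Qed.

Lemma rank_row_inj (w w' : {perm 'I_n}) :
  block_perm w -> block_perm w' ->
  {in block_gaps (enum 'I_n), forall f : 'Hom('rV[R]_n, R^o),
     ((0 : R) < f (rank_row w)) = ((0 : R) < f (rank_row w'))} -> w = w'.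
Proof.
move=> /forallP bw /forallP bw' h.
have b j : beta ((w^-1)%g j) = beta j by rewrite -{2}(permKV w j) (eqP (bw _)).
have b' j : beta ((w'^-1)%g j) = beta j by rewrite -{2}(permKV w' j) (eqP (bw' _)).
have lt i e : beta i = beta e ->
    ((w^-1)%g i < (w^-1)%g e)%N = ((w'^-1)%g i < (w'^-1)%g e)%N.
  move=> bie; have [->|nie] := eqVneq i e; first by rewrite !ltnn.
  case: (mem_block_gaps (mem_enum _ i) (mem_enum _ e) nie bie) => /h.
    by rewrite !gapE !mxE !opprK ![- _ + _]addrC !subr_gt0 !ltr_nat.
  rewrite !gapE !mxE !opprK ![- _ + _]addrC !subr_gt0 !ltr_nat.
  have ne (z : {perm 'I_n}) : nat_of_ord (z i) != z e.
    by rewrite (inj_eq val_inj) (inj_eq perm_inj).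
  move: (ne w^-1%g) (ne w'^-1%g).
  by case: (ltngtP ((w^-1)%g i)); case: (ltngtP ((w'^-1)%g i)).
(* The position of [i] is determined by the number of earlier elements of its
   block. *)
have rk i : (\sum_(q < n | (beta q == beta i) && (q < (w^-1)%g i)) 1 =
             \sum_(q < n | (beta q == beta i) && (q < (w'^-1)%g i)) 1)%N.
  rewrite (reindex_inj (@perm_inj _ (w^-1)%g)) [RHS](reindex_inj (@perm_inj _ (w'^-1)%g)).
  apply: eq_bigl => e /=; rewrite b b'; case: eqP => //= be; exact: lt.
suff : (w^-1)%g = (w'^-1)%g by move/invg_inj.
apply/permP => i; apply: val_inj => /=.
have mono (p q : 'I_n) : beta p = beta i -> beta q = beta i -> (p < q)%N ->
    (\sum_(r < n | (beta r == beta i) && (r < p)) 1 <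
     \sum_(r < n | (beta r == beta i) && (r < q)) 1)%N.
  move=> bp bq pq; rewrite !sum1_card; apply: proper_card; apply/properP; split.
    by apply/fintype.subsetP => r; rewrite -!topredE /= => /andP[-> /ltn_trans ->].
  by exists p; rewrite -!topredE /= bp eqxx ?ltnn.
have [hl|hl|//] := ltngtP ((w^-1)%g i) ((w'^-1)%g i).
  by have := mono _ _ (b i) (b' i) hl; rewrite rk ltnn.
by have := mono _ _ (b' i) (b i) hl; rewrite rk ltnn.
Qed.

(** A region consists of the vectors whose entries are in a given order inside
    every block, and this order is recorded by the permutation sorting them. *)
Lemma card_sorts V :
  #|[set w | block_perm w && `[< sorts V w >]]%SET| =
  nregions (block_gaps (enum 'I_n)) V.
Proof.
set A := finset _; set E := block_gaps _.
pose pat (w : {perm 'I_n}) := [seq (0 : R) < (f : 'Hom('rV[R]_n, R^o)) (rank_row w) | f <- E].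
rewrite /nregions -big_mkcond sum1_count -size_filter cardE -(size_map pat).
apply/perm_size/uniq_perm.
- rewrite map_inj_in_uniq ?enum_uniq // => w w'; rewrite !mem_enum !inE.
  move=> /andP[bw _] /andP[bw' _] /eq_in_map; exact: rank_row_inj.
- by rewrite filter_uniq // uniq_bitseqs.
move=> b; rewrite mem_filter mem_bitseqs; apply/mapP/andP.
  move=> [w]; rewrite mem_enum inE => /andP[bw /asboolP[a aV aw]] ->.
  rewrite size_map; split => //; apply/asboolP; exists a; split=> //.
    by apply/allP => f /(sorts_sign (enum_uniq _) bw aw)[].
  by apply/eq_in_map => f /(sorts_sign (enum_uniq _) bw aw)[].
move=> [/asboolP[a [aV a0 <-]] _].
have [w bw wa] := block_sort (fun i => a 0 i).
have ws p q : beta p = beta q -> (p < q)%N -> a 0 (w q) < a 0 (w p).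
  move=> bpq pq; rewrite lt_neqAle wa // andbT.
  have npq : w p != w q by rewrite (inj_eq perm_inj) -val_eqE /= ltn_eqF.
  have bpq' : beta (w p) = beta (w q) by rewrite !(eqP (forallP bw _)).
  have enumI i : i \in enum 'I_n by rewrite mem_enum.
  by case: (mem_block_gaps (enumI (w p)) (enumI (w q)) npq bpq') =>
     /(allP a0); rewrite gapE subr_eq0 // eq_sym.
exists w.
  by rewrite mem_enum inE bw; apply/asboolP; exists a.
by apply/eq_in_map => f /(sorts_sign (enum_uniq _) bw ws)[].
Qed.

Lemma card_block_perm :
  #|[set w | block_perm w]%SET|%:R = block_weight 1 (enum 'I_n).
Proof.
rewrite -nregions_full ?enum_uniq // -card_sorts; congr (_%:R); apply: eq_card => w.
rewrite !inE; case bw: (block_perm w) => //=; apply/esym/asboolP.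
exists (rank_row w); first by rewrite memvf.
by move=> p q _ pq; rewrite !mxE !permK ltrN2 ltr_nat.
Qed.

End BraidRegions.

(** * Linear relations between vectors in general position *)

Lemma row_full_inj (R : fieldType) m p (M : 'M[R]_(m, p)) :
  (forall c : 'cV[R]_p, M *m c = 0 -> c = 0) -> row_full M.
Proof.
move=> inj; rewrite -cokermx_eq0; apply/eqP/matrixP => i j; rewrite [RHS]mxE.
have : col j (cokermx M) = 0.
  by apply: inj; rewrite colE mulmxA mulmx_coker mul0mx.
by move/colP => /(_ i); rewrite !mxE.
Qed.

Section Relations.
Variables (R : realFieldType) (n d : nat).
Implicit Types (Y : 'M[R]_(n, d)) (a : 'rV[R]_n).

Definition relations Y : {vspace 'rV[R]_n} := lker (linfun (mulmxr Y)).

Lemma mem_relations Y a : (a \in relations Y) = (a *m Y == 0).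
Proof. by rewrite memv_ker lfunE. Qed.

(** General position, in a form stable under permuting and merging the rows.
    It will be applied to rows with zero sum, of which the class sums of [d + 1]
    classes span at most [d] dimensions. *)
Definition generic_classes Y : Prop :=
  forall (phi : 'I_n -> 'I_n) (c : 'cV[R]_d),
    (d < #|[set phi i | i : 'I_n]%SET|)%N ->
    (forall v, \sum_(i | phi i == v) (Y *m c) i 0 = 0) -> c = 0.

Lemma row_perm_mulE Y (s : {perm 'I_n}) (c : 'cV[R]_d) i :
  (row_perm s Y *m c) i 0 = (Y *m c) (s i) 0.
Proof. by rewrite !mxE; apply: eq_bigr => j _; rewrite mxE. Qed.

Lemma generic_row_perm Y (s : {perm 'I_n}) :
  generic_classes Y -> generic_classes (row_perm s Y).
Proof.
move=> gY phi c hphi hc; apply: (gY (phi \o (s^-1)%g)).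
  suff -> : [set (phi \o (s^-1)%g) i | i : 'I_n]%SET = [set phi i | i : 'I_n]%SET by [].
  apply/setP => v; apply/imsetP/imsetP => -[i _ ->].
    by exists ((s^-1)%g i).
  by exists (s i) => //=; rewrite permK.
move=> v; rewrite -[RHS](hc v) (reindex_inj (@perm_inj _ s)) /=.
apply: eq_big => [i|i _]; first by rewrite permK.
by rewrite row_perm_mulE.
Qed.

Lemma dim_relations Y : generic_classes Y -> (d < n)%N ->
  \dim (relations Y) = (n - d)%N.
Proof.
move=> gY dn; have full : row_full Y.
  apply: row_full_inj => c h; apply: (gY id c) => [|v].
    suff -> : [set id i | i : 'I_n]%SET = [set: 'I_n]%SET by rewrite cardsT card_ord.
    by apply/setP => v; rewrite inE; apply/imsetP; exists v.
  by rewrite big1 // => i _; rewrite h mxE.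
have := limg_ker_dim (linfun (mulmxr Y)) (fullv : {vspace 'rV[R]_n}).
rewrite (capv_idPr (subvf _)) -/(relations Y) dimvf /dim /= mul1n.
suff -> : limg (linfun (mulmxr Y)) = fullv :> {vspace 'rV[R]_d}.
  by rewrite dimvf /dim /= mul1n => h; rewrite -[in RHS]h addnK.
apply/eqP; rewrite eqEsubv subvf /=; apply/subvP => v _.
have -> : v = linfun (mulmxr Y) (v *m pinvmx Y).
  by rewrite lfunE /= mulmxKpV // submx_full.
by rewrite memv_img // memvf.
Qed.

Lemma col_span_dual m p (M : 'M[R]_(m, p)) (v : 'cV[R]_m) :
  (forall b : 'rV[R]_m, b *m M = 0 -> b *m v = 0) -> exists c, v = M *m c.
Proof.
move=> h; have : (v^T <= M^T)%MS.
  rewrite submxE -[v^T *m _]trmxK trmx_mul trmxK; apply/eqP.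
  apply/(canLR (@trmxK _ _ _)); rewrite trmx0; apply/row_matrixP => i.
  rewrite row_mul row0; apply: h; rewrite -row_mul.
  suff -> : (cokermx M^T)^T *m M = 0 by apply/rowP => ?; rewrite !mxE.
  by apply: (can_inj (@trmxK _ _ _)); rewrite trmx_mul trmxK mulmx_coker trmx0.
move/submxP => [D hD]; exists D^T.
by apply: (can_inj (@trmxK _ _ _)); rewrite trmx_mul trmxK.
Qed.

(** If [V] (the relations constant on the classes of [phi]) were contained in
    the hyperplane [a_i = a_e], a dual vector would kill all the class sums
    obtained by merging the classes of [i] and [e]. *)
Lemma generic_gen_pos (K : eqType) (beta : 'I_n -> K) Y D s (phi : 'I_n -> 'I_n)
    (V : {vspace 'rV[R]_n}) :
  generic_classes Y -> uniq s -> {in s &, injective phi} ->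
  (D + d < #|[set phi i | i : 'I_n]%SET|)%N ->
  (forall a, (a \in V) <->
     a *m Y = 0 /\ forall p q, phi p = phi q -> a 0 p = a 0 q) ->
  gen_pos beta D s V.
Proof.
move=> gY; elim: s D phi V => [|e s IH] [|D] phi V //= /andP[es us] injs hD hV.
split; first by apply: (IH _ phi) => // p q ps qs; apply: injs; rewrite inE ?ps ?qs orbT.
move=> i iS bie.
have nie : phi i != phi e.
  apply: contraNneq es => /injs <- //; by rewrite !inE ?iS ?eqxx ?orbT.
pose phi' p := if phi p == phi e then phi i else phi p.
have hcard : (D + d < #|[set phi' p | p : 'I_n]%SET|)%N.
  have -> : [set phi' p | p : 'I_n]%SET = ([set phi p | p : 'I_n] :\ phi e)%SET.
    apply/setP => v; rewrite !inE; apply/imsetP/andP.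
      move=> [p _ ->]; rewrite /phi'; case: ifPn => h; split=> //; exact: imset_f.
    move=> [ve /imsetP[p _ vp]]; exists p => //.
    by rewrite /phi' -vp (negbTE ve).
  have hin : phi e \in [set phi p | p : 'I_n]%SET by apply/imsetP; exists e.
  by move: hD; rewrite (cardsD1 (phi e) [set phi p | p : 'I_n]%SET) hin addSn add1n ltnS.
have phi'_const p q : phi p = phi q -> phi' p = phi' q by rewrite /phi' => ->.
split; last first.
  apply: (IH _ phi') => //.
    move=> p q ps qs; rewrite /phi'.
    have ne r : r \in s -> (phi r == phi e) = false.
      move=> rs; apply/negbTE; apply: contraNneq es => /injs <- //.
        by rewrite inE rs orbT.
      by rewrite mem_head.
    by rewrite !ne //; apply: injs; rewrite inE ?ps ?qs orbT.
  move=> a; rewrite memv_cap memv_ker gapE subr_eq0; split.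
    move=> /andP[/hV[aY ac] /eqP aie]; split=> // p q; rewrite /phi'.
    by case: eqP => [hp|_]; case: eqP => [hq|_] h; rewrite ?(ac _ _ hp) ?(ac _ _ hq) //
       -?aie ?(ac _ _ h) // -(ac _ _ h).
  move=> [aY ac]; apply/andP; split.
    by apply/hV; split=> // p q /phi'_const /ac.
  by apply/eqP/ac; rewrite /phi' (negbTE nie) eqxx.
apply/negP => /subvP sub.
pose Phi : 'M[R]_n := \matrix_(v, p) (phi p == v)%:R.
have PhiE m (B : 'M[R]_(n, m)) v j : (Phi *m B) v j = \sum_(p | phi p == v) B p j.
  rewrite mxE [RHS]big_mkcond; apply: eq_bigr => p _.
  by rewrite mxE; case: eqP => _; rewrite ?mul1r ?mul0r.
have [c hc] : exists c, (delta_mx (phi i) 0 - delta_mx (phi e) 0 : 'cV[R]_n) = Phi *m Y *m c.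
  apply: col_span_dual => b; rewrite mulmxA => hb.
  have bPhi p : (b *m Phi) 0 p = b 0 (phi p).
    rewrite mxE (bigD1 (phi p)) //= mxE eqxx mulr1 big1 ?addr0 // => v vp.
    by rewrite mxE eq_sym (negbTE vp) mulr0.
  have /sub : b *m Phi \in V.
    by apply/hV; split => // p q; rewrite !bPhi => ->.
  rewrite memv_ker gapE !bPhi => /eqP h.
  by apply/matrixP => x y; rewrite !ord1 mulmxBr -!colE !mxE.
have h v : \sum_(p | phi p == v) (Y *m c) p 0 = (v == phi i)%:R - (v == phi e)%:R.
  by rewrite -PhiE mulmxA -hc !mxE !eqxx !andbT.
have c0 : c = 0.
  apply: (gY phi').
    by apply: leq_ltn_trans hcard; rewrite leq_addl.
  move=> v; have [->|vi] := eqVneq v (phi i).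
    have -> : \sum_(p | phi' p == phi i) (Y *m c) p 0 =
        \sum_(p | phi p == phi i) (Y *m c) p 0 + \sum_(p | phi p == phi e) (Y *m c) p 0.
      rewrite (bigID (fun p => phi p == phi i)) /=; congr (_ + _); apply: eq_bigl => p.
        rewrite /phi'; case: (eqVneq (phi p) (phi i)) => [->|]; rewrite ?andbF //.
        by rewrite (negbTE nie) eqxx.
      rewrite /phi'; case: (eqVneq (phi p) (phi e)) => [->|]; rewrite ?eqxx.
        by rewrite eq_sym nie.
      by rewrite andbN.
    by rewrite !h !eqxx (negbTE nie) eq_sym (negbTE nie) subr0 sub0r subrr.
  have [->|ve] := eqVneq v (phi e).
    rewrite big_pred0 // => p; rewrite /phi'; case: ifPn => [_|/negbTE //].
    exact/negbTE.
  have -> : \sum_(p | phi' p == v) (Y *m c) p 0 = \sum_(p | phi p == v) (Y *m c) p 0.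
    apply: eq_bigl => p; rewrite /phi'; case: (phi p =P phi e) => // ->.
    by rewrite ![_ == v]eq_sym (negbTE vi) (negbTE ve).
  by rewrite h (negbTE vi) (negbTE ve) subrr.
have := h (phi i); rewrite c0 mulmx0 big1 => [|p _]; last by rewrite mxE.
by rewrite eqxx (negbTE nie) subr0 => /esym/eqP; rewrite oner_eq0.
Qed.

Section Descents.
Variables (K : eqType) (beta : 'I_n -> K).

Definition descends Y : Prop := exists2 a : 'rV[R]_n, a *m Y = 0 &
  forall p q, beta p = beta q -> (p < q)%N -> a 0 q < a 0 p.

Lemma sorts_relations Y w : sorts beta (relations Y) w <-> descends (row_perm w Y).
Proof.
have colrow (a : 'rV[R]_n) : col_perm w a *m row_perm w Y = a *m Y.
  by rewrite col_permE row_permE mulmxA -(mulmxA a) -perm_mxM mulVg perm_mx1 mulmx1.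
split=> [[a]|[a aY ha]].
  rewrite mem_relations => /eqP aY ha; exists (col_perm w a); first by rewrite colrow.
  by move=> p q bpq pq; rewrite !mxE ha.
have aw : col_perm w (col_perm w^-1%g a) = a.
  by apply/rowP => j; rewrite !mxE permK.
exists (col_perm w^-1%g a).
  by rewrite mem_relations -colrow aw aY.
by move=> p q bpq pq; rewrite !mxE !permK ha.
Qed.

(** Averaging over the cosets of the group of block-preserving permutations:
    on each coset the permutations counted are the regions of one arrangement. *)
Lemma card_descends Y :
  (#|[set w | block_perm beta w]%SET| *
     #|[set s : {perm 'I_n} | `[< descends (row_perm s Y) >]]%SET| =
  \sum_(s : {perm 'I_n}) nregions (block_gaps R beta (enum 'I_n)) (relations (row_perm s Y)))%N.
Proof.
under eq_bigr => s _.
  rewrite -card_sorts -sum1dep_card.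
  rewrite (eq_bigr (fun=> 1%N)) // big_mkcondr /=.
  under eq_bigr => w bw.
    rewrite (_ : `[< sorts beta (relations (row_perm s Y)) w >] =
       `[< descends (row_perm (w * s)%g Y) >]); last first.
      apply/asboolP/asboolP => [/sorts_relations|h]; last apply/sorts_relations.
        by rewrite row_permM.
      by rewrite -row_permM.
    over.
  over.
rewrite exchange_big /= -sum_nat_const big_mkcond [RHS]big_mkcond /=.
apply: eq_bigr => w _; rewrite inE; case: ifP => // _.
rewrite (reindex_inj (mulgI w^-1%g)) /= -sum1dep_card big_mkcond /=.
by apply: eq_bigr => s _; rewrite mulgA mulgV mul1g.
Qed.

Lemma card_descends_le (t : R) Y : generic_classes Y -> (d < n)%N -> 1 <= t ->
  #|[set s : {perm 'I_n} | `[< descends (row_perm s Y) >]]%SET|%:R * t ^+ d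
  <= n`!%:R * (block_weight beta t (enum 'I_n) / block_weight beta 1 (enum 'I_n)).
Proof.
move=> gY dn t1; have t0 : 0 < t by apply: lt_le_trans t1.
have b1 : 0 < block_weight beta (1 : R) (enum 'I_n) by apply: block_weight_gt0.
rewrite mulrA ler_pdivlMr // -(card_block_perm R) mulrAC -natrM mulnC card_descends.
have tn : 0 < t ^+ (n - d) by rewrite exprn_gt0.
rewrite -(ler_pM2r tn) -mulrA -exprD subnKC ?(ltnW dn) // natr_sum mulr_suml.
rewrite -mulrA (mulrC (block_weight _ _ _)).
have -> : n`!%:R = \sum_(s : {perm 'I_n}) (1 : R).
  by rewrite sumr_const card_Sn.
rewrite mulr_suml; apply: ler_sum => s _; rewrite mul1r.
have := nregions_le beta (relations (row_perm s Y)) t1 (enum_uniq 'I_n).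
by rewrite dim_relations ?size_enum_ord //; apply: generic_row_perm.
Qed.

Lemma card_descends_ge (t : R) Y : generic_classes Y -> (d < n)%N -> 0 < t <= 1 ->
  (n`!%:R - #|[set s : {perm 'I_n} | `[< descends (row_perm s Y) >]]%SET|%:R) * t ^+ d.+1
  <= n`!%:R * (block_weight beta t (enum 'I_n) / block_weight beta 1 (enum 'I_n)).
Proof.
move=> gY dn /andP[t0 t1].
have b1 : 0 < block_weight beta (1 : R) (enum 'I_n) by apply: block_weight_gt0.
rewrite mulrA ler_pdivlMr // mulrAC mulrBl -(card_block_perm R) -!natrM.
rewrite [X in (_ - X%:R)]mulnC card_descends.
have tn : 0 < t ^+ (n - d.+1) by rewrite exprn_gt0.
rewrite -(ler_pM2r tn) -mulrA -exprD subnKC // natr_sum.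
rewrite natrM card_block_perm.
rewrite -[leRHS]mulrA (mulrC (block_weight _ _ _)).
have -> : n`!%:R = \sum_(s : {perm 'I_n}) (1 : R).
  by rewrite sumr_const card_Sn.
rewrite !mulr_suml -sumrB mulr_suml; apply: ler_sum => s _; rewrite !mul1r.
have gen : gen_pos beta (n - d.+1) (enum 'I_n) (relations (row_perm s Y)).
  apply: (@generic_gen_pos _ _ (row_perm s Y) _ _ id) => //.
  - exact: generic_row_perm.
  - exact: enum_uniq.
  - suff -> : [set id i | i : 'I_n]%SET = [set: 'I_n]%SET.
      by rewrite cardsT card_ord -ltn_subRL; lia.
    by apply/setP => v; rewrite inE; apply/imsetP; exists v.
  - move=> a; rewrite mem_relations; split=> [/eqP -> |[->]] //.
    by split => // p q ->.
have tt : 0 < t <= 1 by rewrite t0.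
by have := nregions_ge tt (enum_uniq 'I_n) gen; rewrite size_enum_ord.
Qed.

End Descents.
End Relations.

(** * Supporting hyperplanes and cyclic descents *)

Section Gordan.
Variables (R : realFieldType) (U : vectType R) (J : eqType).

(** Gordan's alternative, by induction on the number of forms: solutions for
    the other forms on [V] and on the kernel of the new form combine to a
    solution, unless the relation found on that kernel extends to [V]. *)
Lemma gordan (f : J -> 'Hom(U, R^o)) (l : seq J) (V : {vspace U}) : uniq l ->
  (exists2 u, u \in V & {in l, forall j, (0 : R) < f j u}) \/
  (exists z : J -> R, [/\ {in l, forall j, 0 <= z j},
      exists2 j, j \in l & 0 < z j &
      forall u, u \in V -> \sum_(j <- l) z j * (f j u : R) = 0]).
Proof.
elim: l V => [|i l IH] V /=; first by move=> _; left; exists 0; rewrite ?mem0v.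
move=> /andP[il ul].
have extend (z : J -> R) (r : R) u :
    \sum_(j <- i :: l) (if j == i then r else z j) * (f j u : R) =
    r * (f i u : R) + \sum_(j <- l) z j * (f j u : R).
  rewrite big_cons eqxx; congr (_ + _); rewrite !big_seq; apply: eq_bigr => j jl.
  by rewrite (_ : (j == i) = false) //; apply: contraNF il => /eqP <-.
have notin j : j \in l -> (j == i) = false.
  by move=> jl; apply: contraNF il => /eqP <-.
case: (IH V ul) => [[c cV hc]|[z [z0 [j jl zj] zV]]]; last first.
  right; exists (fun j => if j == i then 0 else z j); split.
  - by move=> k; rewrite inE; case: eqP => //= _ /z0.
  - by exists j; rewrite ?inE ?jl ?orbT // notin.
  - by move=> u uV; rewrite extend mul0r add0r zV.
case: (IH (V :&: lker (f i))%VS ul) => [[c0]|[z [z0 [j jl zj] zV]]].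
  rewrite memv_cap memv_ker => /andP[c0V /eqP fc0] hc0.
  have [Vf|/subvPn[v vV]] := boolP (V <= lker (f i))%VS.
    right; exists (fun j => if j == i then 1 else 0); split.
    - by move=> k _; case: ifP.
    - by exists i; rewrite ?mem_head // eqxx.
    - move=> u uV; rewrite (extend (fun=> 0)) big1 ?addr0 ?mul1r; last first.
        by move=> k _; rewrite mul0r.
      by apply/eqP; rewrite -memv_ker (subvP Vf).
  rewrite memv_ker => fv0; left.
  have c0E : all (fun g : 'Hom(U, R^o) => g c0 != 0) (map f l).
    by apply/allP => _ /mapP[k kl ->]; apply: lt0r_neq0; apply: hc0.
  have [e e0 he] := signs_perturb v c0E.
  pose r := Num.sg (f i v : R) * e.
  have re : `|r| <= e by rewrite normrM normr_sg fv0 mul1r gtr0_norm.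
  have [h1 h2] := he r re; exists (c0 + r *: v); first by rewrite memvD // memvZ.
  move=> k; rewrite inE => /predU1P[->|kl].
    rewrite linearD linearZ /= fc0 add0r.
    rewrite (_ : r *: f i v = r * (f i v : R)) // /r mulrAC -normrEsg.
    by rewrite mulr_gt0 // normr_gt0.
  by move/eq_in_map: h2 => /(_ (f k) (map_f f kl)) ->; apply: hc0.
have s0 : 0 < \sum_(j <- l) z j * (f j c : R).
  rewrite (perm_big _ (perm_to_rem jl)) big_cons ltr_pwDl ?mulr_gt0 ?hc //.
  rewrite big_seq sumr_ge0 // => k /mem_rem kl.
  by rewrite mulr_ge0 ?z0 // ltW // hc.
set s := \sum_(_ <- _) _ in s0.
have [fc|fc] := ltP (0 : R) (f i c).
  left; exists c => // k; rewrite inE => /predU1P[->//|]; exact: hc.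
have fcn : (f i c : R) < 0.
  rewrite lt_neqAle fc andbT; apply/eqP => fc0.
  by move: s0; rewrite /s zV ?ltxx // memv_cap cV memv_ker fc0 eqxx.
right; exists (fun j => if j == i then - s / (f i c : R) else z j); split.
- move=> k; rewrite inE; case: eqP => /= _ => [_|/z0//].
  by rewrite ltW // nmulr_rgt0 ?oppr_lt0 // invr_lt0.
- by exists j; rewrite ?inE ?jl ?orbT // notin.
move=> u uV; rewrite extend.
set q : R := (f i u : R) / (f i c : R).
have hk : u - q *: c \in (V :&: lker (f i))%VS.
  rewrite memv_cap memvB ?memvZ //= memv_ker linearB linearZ /= subr_eq0.
  by rewrite (_ : q *: f i c = q * (f i c : R)) // /q divfK // lt_eqF.
have := zV _ hk.
under eq_bigr => k _ do rewrite linearB linearZ /= mulrBr.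
rewrite sumrB => /eqP; rewrite subr_eq0 => /eqP ->.
have -> : \sum_(k <- l) z k * (q *: (f k c : R^o) : R) = q * s.
  by rewrite mulr_sumr; apply: eq_bigr => k _; rewrite mulrCA.
rewrite /q; have h : (f i c : R) != 0 by rewrite lt_eqF.
set x : R := f i u; set y : R := f i c in h *.
by field.
Qed.

End Gordan.

Section CyclicOrder.
Variable N : nat.
Local Notation n := N.+1.

Lemma val_iter_ordS m (p : 'I_n) : iter m (@ordS n) p = ((p + m) %% n)%N :> nat.
Proof.
elim: m => [|m IH]; first by rewrite addn0 modn_small.
by rewrite iterS /= IH -addn1 modnDml addn1 addnS.
Qed.

Lemma iter_ordS_surj (p q : 'I_n) : exists m, iter m (@ordS n) p = q.
Proof.
exists (q + n - p)%N; apply: val_inj; rewrite /= val_iter_ordS.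
have pn := ltn_ord p; rewrite subnKC; last by lia.
by rewrite modnDr modn_small.
Qed.

Lemma ordS_invariant (T : Type) (g : 'I_n -> T) :
  (forall p, g (ordS p) = g p) -> forall p q, g p = g q.
Proof.
move=> hg p q; have [m <-] := iter_ordS_surj p q.
by elim: m => //= m ->; rewrite hg.
Qed.

Lemma sum_by_parts (R : comPzRingType) (a f : 'I_n -> R) :
  \sum_p a p * (f p - f (ord_pred p)) = \sum_p (a p - a (ordS p)) * f p.
Proof.
under eq_bigr do rewrite mulrBr.
under [RHS]eq_bigr do rewrite mulrBl.
rewrite !sumrB; congr (_ - _).
by rewrite (reindex_inj (can_inj (@ordSK n))) /=; apply: eq_bigr => p _; rewrite ordSK.
Qed.

End CyclicOrder.

Section SupportingHyperplanes.
Variables (R : realType) (N d : nat).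
Local Notation n := N.+1.
Implicit Types (P Y : 'M[R]_(n, d)) (I : {set 'I_n}).

Definition cyclic_increments P : 'M[R]_(n, d) :=
  \matrix_(p, l) (P p l - P (ord_pred p) l).

Lemma cyclic_incrementsE P (c : 'cV[R]_d) p :
  (cyclic_increments P *m c) p 0 = (P *m c) p 0 - (P *m c) (ord_pred p) 0.
Proof.
by rewrite !mxE -sumrB; apply: eq_bigr => j _; rewrite !mxE mulrBl.
Qed.

Definition exposed P I : Prop := exists (c : 'cV[R]_d) (b : R),
  forall p, if p \in I then (P *m c) p 0 = b else (P *m c) p 0 < b.

(** The obstruction to being the vertex set of a face. After summation by parts
    a relation [a] between the increments is an affine relation between the
    points, with coefficients [a p - a (ordS p)]: these are positive off [I]. *)
Definition cyclic_descent Y I : Prop := exists2 a : 'rV[R]_n, a *m Y = 0 &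
  forall p, p \notin I -> a 0 (ordS p) < a 0 p.

(** More than [d] points on a hyperplane would cut the cyclic sequence of
    increments into as many arcs on which the functional [c] has zero sum. *)
Lemma card_on_hyperplane P (c : 'cV[R]_d) (b : R) :
  generic_classes (cyclic_increments P) -> c != 0 ->
  (#|[set p | (P *m c) p 0%R == b]%SET| <= d)%N.
Proof.
move=> gY; set J := finset _; apply: contraNT; rewrite -ltnNge => dJ.
have /card_gt0P[j0 j0J] : (0 < #|J|)%N by lia.
(* [phi p] is the first point of [J] from [p] on; the arcs ending at points of
   [J] are its fibres. *)
have ex p : exists m, iter m (@ordS n) p \in J.
  by have [m hm] := iter_ordS_surj p j0; exists m; rewrite hm.
pose phi p := iter (ex_minn (ex p)) (@ordS n) p.
have phiJ p : p \in J -> phi p = p.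
  by rewrite /phi; case: ex_minnP => -[//|m] _ /(_ 0%N) h /h.
have phiS p : p \notin J -> phi (ordS p) = phi p.
  rewrite /phi; case: ex_minnP => m mJ hm; case: ex_minnP => -[|m'].
    by move=> /= pJ; rewrite pJ.
  rewrite iterSr => m'J hm' pJ; congr iter.
  apply/eqP; rewrite eqn_leq hm //= -ltnS; apply: hm'.
  by rewrite iterSr.
apply/eqP; apply: (gY phi).
  apply: leq_trans dJ _; apply: subset_leq_card; apply/fintype.subsetP => p pJ.
  by apply/imsetP; exists p; rewrite ?phiJ.
move=> v; pose f p := (P *m c) p 0 - b.
have -> : \sum_(p | phi p == v) (cyclic_increments P *m c) p 0 =
    \sum_p (phi p == v)%:R * (f p - f (ord_pred p)).
  rewrite big_mkcond; apply: eq_bigr => p _; rewrite cyclic_incrementsE /f.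
  by case: eqP => _; rewrite ?mul1r ?mul0r //; ring.
rewrite sum_by_parts big1 // => p _.
have [pJ|pJ] := boolP (p \in J).
  by move: pJ; rewrite inE => /eqP h; rewrite /f h subrr mulr0.
by rewrite phiS // subrr mul0r.
Qed.

Lemma affine_frame_unit P (f : 'I_(1 + d) -> 'I_n) :
  generic_classes (cyclic_increments P) -> injective f ->
  rowsub f (row_mx (const_mx 1 : 'cV[R]_n) P) \in unitmx.
Proof.
move=> gY injf; rewrite -row_full_unit; apply: row_full_inj => c hc.
pose b := - (usubmx c) 0 0; pose v : 'cV[R]_d := dsubmx c.
have hb k : (P *m v) (f k) 0 = b.
  have := congr1 (fun M : 'M[R]_(_, _) => M k 0) hc.
  rewrite -{1}(vsubmxK c) !mxE.
  under eq_bigr => j _ do rewrite mxE.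
  rewrite big_split_ord /= big_ord1 row_mxEl mxE mul1r col_mxEu.
  under eq_bigr => j _ do rewrite row_mxEr col_mxEd.
  by move/eqP; rewrite addrC addr_eq0 => /eqP; rewrite /b.
have v0 : v = 0.
  apply/eqP; apply: contraT => v0.
  have := card_on_hyperplane b gY v0; rewrite leqNgt => /negP[].
  have <- : #|[set f k | k : 'I_(1 + d)]%SET| = d.+1 by rewrite card_imset // card_ord.
  apply: subset_leq_card; apply/fintype.subsetP => _ /imsetP[k _ ->].
  by rewrite inE hb.
have b0 : usubmx c = 0.
  apply/matrixP => i j; rewrite !ord1 [RHS]mxE; apply/eqP.
  rewrite -oppr_eq0 -/b -(hb 0) v0 mulmx0 mxE //.
by rewrite -(vsubmxK c) b0 -/v v0 col_mx0.
Qed.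

(** Any [d + 1] of the points are affinely independent, so an affine function
    can be prescribed on them. *)
Lemma affine_interpolation P (J : {set 'I_n}) (u : 'I_n -> R) :
  generic_classes (cyclic_increments P) -> (d < n)%N -> (#|J| <= d.+1)%N ->
  exists (c : 'cV[R]_d) (b : R), {in J, forall p, (P *m c) p 0 + b = u p}.
Proof.
move=> gY dn Jd.
pose s := enum J ++ enum (~: J)%SET.
have us : uniq s.
  rewrite cat_uniq !enum_uniq andbT /=; apply/hasPn => p.
  by rewrite !mem_enum inE.
have ss : size s = n by rewrite size_cat -!cardE cardsC card_ord.
pose f (k : 'I_(1 + d)) := nth ord0 s k.
have injf : injective f.
  move=> k k' /eqP; rewrite nth_uniq ?ss // => [/eqP /val_inj //||];
    by apply: leq_trans (ltn_ord _) _.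
have M_unit := affine_frame_unit gY injf.
set M := rowsub _ _ in M_unit.
pose c := invmx M *m (\col_k u (f k)).
exists (dsubmx c), (usubmx c 0 0) => p pJ.
have ps : p \in s by rewrite mem_cat mem_enum pJ.
have pd : (index p s < 1 + d)%N.
  apply: leq_trans Jd; rewrite index_cat mem_enum pJ cardE index_mem.
  by rewrite mem_enum.
have fp : f (Ordinal pd) = p by rewrite /f nth_index.
have : (M *m c) (Ordinal pd) 0 = u p by rewrite mulKVmx // mxE fp.
rewrite -{1}(vsubmxK c) mxE.
under eq_bigr => j _ do rewrite mxE.
rewrite big_split_ord /= big_ord1 row_mxEl mxE mul1r col_mxEu.
under eq_bigr => j _ do rewrite row_mxEr col_mxEd.
by rewrite fp addrC => <-; congr (_ + _); rewrite mxE.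
Qed.

Lemma exposed_sum P I (a : 'I_n -> R) (c : 'cV[R]_d) (b : R) :
  \sum_p a p * (cyclic_increments P *m c) p 0 =
  \sum_p (a p - a (ordS p)) * ((P *m c) p 0 - b).
Proof.
rewrite -sum_by_parts; apply: eq_bigr => p _.
by rewrite cyclic_incrementsE; congr (_ * _); ring.
Qed.

(** Duality: if no relation descends, Gordan's alternative gives a
    nonnegative function vanishing on [I] whose cyclic differences are given
    by a dual vector, that is, a supporting hyperplane through [I]; its
    points are affinely independent, so that it can be tilted away from
    those outside [I]. *)
Lemma exposed_of_no_descent P I : generic_classes (cyclic_increments P) ->
  (d < n)%N -> (0 < #|I|)%N ->
  ~ cyclic_descent (cyclic_increments P) I -> exposed P I.
Proof.
set Y := cyclic_increments P => gY dn I0 nodesc.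
have [[a]|[z [z0 [j jI zj] zV]]] :=
    gordan (fun p => gap R p (ordS p)) (relations Y) (enum_uniq (~: I)%SET).
  rewrite mem_relations => /eqP aY ha; case: nodesc; exists a => // p pI.
  by have := ha p; rewrite mem_enum inE => /(_ pI); rewrite gapE subr_gt0.
pose zeta p := if p \in I then 0 else z p.
have zeta0 p : 0 <= zeta p.
  by rewrite /zeta; case: ifPn => // pI; apply: z0; rewrite mem_enum inE.
have zetaV (a : 'rV[R]_n) : a *m Y = 0 -> \sum_p (a 0 p - a 0 (ordS p)) * zeta p = 0.
  move=> aY; rewrite -[RHS](zV a); last by rewrite mem_relations aY.
  rewrite big_enum [RHS]big_mkcond /=; apply: eq_bigr => p _.
  by rewrite inE /zeta gapE; case: ifP => _; rewrite ?mulr0 // mulrC.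
have [c hc] : exists c, (\col_p (zeta p - zeta (ord_pred p)) : 'cV[R]_n) = Y *m c.
  apply: col_span_dual => a /zetaV h; apply/matrixP => x y; rewrite !ord1 mxE [RHS]mxE.
  under eq_bigr => p _ do rewrite mxE.
  by rewrite (sum_by_parts (a 0)).
have const : forall p q, (P *m c) p 0 - zeta p = (P *m c) q 0 - zeta q.
  apply: (ordS_invariant (g := fun p => (P *m c) p 0 - zeta p)) => p.
  have := congr1 (fun M : 'M[R]_(_, _) => M (ordS p) 0) hc.
  rewrite mxE cyclic_incrementsE ordSK => h; lra.
have [i0 i0I] := card_gt0P I0.
pose b := (P *m c) i0 0.
have Pc p : (P *m c) p 0 = zeta p + b.
  have := const p i0; rewrite /b {2}/zeta i0I; lra.
have jI' : j \notin I by move: jI; rewrite mem_enum inE.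
have c0 : c != 0.
  apply/eqP => c0; have := Pc j; have := Pc i0; rewrite c0 mulmx0 !mxE.
  rewrite /zeta i0I (negbTE jI'); move: zj; lra.
pose J := [set p | (P *m c) p 0 == b]%SET.
have Jd : (#|J| <= d.+1)%N by apply: leqW; apply: card_on_hyperplane.
have [c' [b' hc']] := affine_interpolation (fun p => (p \notin I)%:R) gY dn Jd.
pose w p := (P *m c') p 0 + b'.
(* So small that [zeta p + eps * w p] stays positive wherever [zeta p] is. *)
pose eps : R := (1 + \sum_p `|w p| / zeta p)^-1.
have sum0 : 0 <= \sum_p `|w p| / zeta p.
  by apply: sumr_ge0 => p _; rewrite divr_ge0.
have eps0 : 0 < eps by rewrite invr_gt0 ltr_pwDl.
have small p : 0 < zeta p -> 0 < zeta p + eps * w p.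
  move=> zp; have : eps * `|w p| < zeta p.
    rewrite /eps mulrC ltr_pdivrMr ?ltr_pwDl // mulrC -ltr_pdivrMr //.
    rewrite (bigD1 p) //= addrCA ltrDl ltr_pwDl // sumr_ge0 // => q _.
    by rewrite divr_ge0.
  have : - (eps * `|w p|) <= eps * w p.
    by rewrite -mulrN ler_pM2l // lerNl ler_normr lexx orbT.
  lra.
exists (- (c + eps *: c')), (- (b - eps * b')) => p.
have -> : (P *m (- (c + eps *: c'))) p 0 = - (b - eps * b') - (zeta p + eps * w p).
  rewrite mulmxN mulmxDr -scalemxAr mxE [(_ + _ : 'M[R]_(_, _)) _ _]mxE Pc.
  by rewrite [(_ *: _ : 'M[R]_(_, _)) _ _]mxE /w; ring.
have [zp|zp] := eqVneq (zeta p) 0.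
  have pJ : p \in J by rewrite inE Pc zp add0r.
  have := hc' p pJ; rewrite -/(w p) => ->; rewrite zp add0r.
  by case: (p \in I) => /=; rewrite ?mulr0 ?subr0 // mulr1 gtrBl.
rewrite (_ : (p \in I) = false); last first.
  by apply/negbTE; apply: contraNN zp; rewrite /zeta => ->.
by rewrite gtrBl small // lt_neqAle eq_sym zp zeta0.
Qed.

(** An approximate form of [cyclic_descent] with integral coefficients: it is a
    countable combination of closed conditions on [Y], hence measurable. *)
Definition integral_descent Y I : Prop := exists B : nat, forall m : nat,
  exists z : {ffun 'I_n -> int},
    (forall p, p \notin I -> m%:Z <= z p - z (ordS p)) /\
    (forall l, `|\sum_p (z p)%:~R * Y p l| <= B%:R).

(** Scale the relation until all descents exceed [m + 1] and round it down: the
    rounding error does not depend on the scale. *)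
Lemma integral_of_descent Y I : cyclic_descent Y I -> integral_descent Y I.
Proof.
move=> [a aY ha]; pose S := \sum_p \sum_l `|Y p l|.
have S0 : 0 <= S by apply: sumr_ge0 => p _; apply: sumr_ge0.
exists (Num.truncn S).+1 => m.
pose K := \sum_(p | p \notin I) (m%:R + 1) / (a 0 p - a 0 (ordS p)).
have K0 p : p \notin I -> m%:R + 1 <= K * a 0 p - K * a 0 (ordS p).
  move=> pI; have g0 : 0 < a 0 p - a 0 (ordS p) by rewrite subr_gt0 ha.
  rewrite -mulrBr -ler_pdivrMr // /K (bigD1 p) //= lerDl sumr_ge0 // => q /andP[qI _].
  by apply: divr_ge0; [rewrite addr_ge0 | rewrite subr_ge0 ltW // ha].
exists [ffun p => Num.floor (K * a 0 p)]; split.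
  move=> p /K0 h; rewrite !ffunE -(ler_int R) intrB.
  have := floor_le (K * a 0 (ordS p)); have := floorD1_gt (K * a 0 p).
  rewrite intrD; set x := (Num.floor _)%:~R; set y := (Num.floor _)%:~R.
  rewrite -[(m%:Z)%:~R]/(m%:R : R) -[1%:~R]/(1 : R); lra.
move=> l; apply: (@le_trans _ _ S); last first.
  by rewrite ltW // truncnS_gt.
have -> : \sum_p ([ffun p => Num.floor (K * a 0 p)] p)%:~R * Y p l =
    \sum_p ((Num.floor (K * a 0 p))%:~R - K * a 0 p) * Y p l.
  under [RHS]eq_bigr => p _ do rewrite mulrBl -mulrA.
  rewrite sumrB -mulr_sumr.
  have := congr1 (fun M : 'M[R]_(_, _) => M 0 l) aY; rewrite !mxE => ->.
  by rewrite mulr0 subr0; apply: eq_bigr => p _; rewrite ffunE.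
apply: le_trans (ler_norm_sum _ _ _) _; apply: ler_sum => p _.
apply: (@le_trans _ _ `|Y p l|).
  rewrite normrM ler_piMl // distrC ger0_norm ?subr_ge0 ?floor_le //.
  by rewrite lerBlDl ltW // -[1]/(1%:~R) -intrD floorD1_gt.
by rewrite (bigD1 l) //= lerDl sumr_ge0.
Qed.

(** Pairing a relation with the exposing functional: each descent contributes
    at least [m] times a fixed amount of the same sign, whereas the total stays
    bounded. *)
Lemma no_descent_of_exposed P I : (#|I| < n)%N -> exposed P I ->
  ~ integral_descent (cyclic_increments P) I.
Proof.
move=> In [c [b hcb]] [B hB].
have [j jI] : exists j, j \notin I.
  have /card_gt0P[j] : (0 < #|~: I|)%N by have := cardsC I; rewrite card_ord; lia.
  by rewrite inE; exists j.
have fj : (P *m c) j 0 < b by have := hcb j; rewrite (negbTE jI).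
pose eta := b - (P *m c) j 0; have eta0 : 0 < eta by rewrite subr_gt0.
pose C := \sum_l `|c l 0|; have C0 : 0 <= C by apply: sumr_ge0.
pose m := (Num.truncn (B%:R * C / eta)).+1.
have hm : B%:R * C < m%:R * eta by rewrite -ltr_pdivrMr // truncnS_gt.
have [z [hz hl]] := hB m.
have := exposed_sum P I (fun p => (z p)%:~R) c b.
have -> : \sum_p (z p)%:~R * (cyclic_increments P *m c) p 0 =
   \sum_l (\sum_p (z p)%:~R * cyclic_increments P p l) * c l 0.
  under [RHS]eq_bigr do rewrite mulr_suml.
  rewrite exchange_big; apply: eq_bigr => p _; rewrite mxE mulr_sumr.
  by apply: eq_bigr => l _; rewrite mulrA.
move=> h.
have : `|\sum_l (\sum_p (z p)%:~R * cyclic_increments P p l) * c l 0| <= B%:R * C.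
  apply: le_trans (ler_norm_sum _ _ _) _; rewrite mulr_sumr; apply: ler_sum => l _.
  by rewrite normrM ler_wpM2r.
rewrite h; apply/negP; rewrite -ltNge; apply: lt_le_trans hm _.
rewrite -normrN; apply: le_trans (ler_norm _); rewrite -sumrN (bigD1 j) //=.
rewrite -mulrN opprB -/eta -[leLHS]addr0 lerD //.
  by rewrite ler_pM2r // -intrB -[m%:R]/((m%:Z)%:~R) ler_int hz.
apply: sumr_ge0 => p _; have := hcb p; case: ifPn => pI.
  by move=> ->; rewrite subrr mulr0 oppr0.
move=> hp; rewrite -mulrN; apply: mulr_ge0; last by rewrite oppr_ge0 subr_le0 ltW.
by rewrite -intrB ler0z; apply: le_trans (hz p pI).
Qed.

Lemma exposed_iff P I : generic_classes (cyclic_increments P) ->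
  (d < n)%N -> (0 < #|I| < n)%N ->
  (exposed P I <-> ~ integral_descent (cyclic_increments P) I).
Proof.
move=> gY dn /andP[I0 IT]; split; first exact: no_descent_of_exposed.
by move=> h; apply: exposed_of_no_descent => // /integral_of_descent.
Qed.

Lemma descent_iff P I : generic_classes (cyclic_increments P) ->
  (d < n)%N -> (0 < #|I| < n)%N ->
  (integral_descent (cyclic_increments P) I <->
   cyclic_descent (cyclic_increments P) I).
Proof.
move=> gY dn /andP[I0 IT]; split; last exact: integral_of_descent.
move=> h; apply: contrapT => /(exposed_of_no_descent gY dn I0) /no_descent_of_exposed.
exact.
Qed.

End SupportingHyperplanes.

(** * General position of reordered walks *)

Lemma card_ord_lt (N m : nat) : (m <= N)%N -> #|[set q : 'I_N | (q < m)%N]%SET| = m.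
Proof.
by move=> mN; rewrite -sum1dep_card -(big_ord_widen N (fun=> 1%N) mN) sum1_card card_ord.
Qed.

Lemma mem_initial_segment (N : nat) (D : {set 'I_N}) (p : 'I_N) :
  (forall p q : 'I_N, (p <= q)%N -> q \in D -> p \in D) ->
  (p \in D) = (p < #|D|)%N.
Proof.
move=> hD; apply/idP/idP => [pD|].
  have <- := card_ord_lt (ltn_ord p); apply: subset_leq_card.
  by apply/fintype.subsetP => q; rewrite inE ltnS => /hD; apply.
apply: contraLR => pD; rewrite -leqNgt.
rewrite -[X in (_ <= X)%N](card_ord_lt (ltnW (ltn_ord p))); apply: subset_leq_card.
apply/fintype.subsetP => q qD; rewrite inE ltnNge; apply: contra pD => pq.
exact: hD pq qD.
Qed.

Section Walks.
Variables (R : realType) (N d : nat).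
Local Notation n := N.+1.
Implicit Types (x : 'I_N -> 'rV[R]_d).

Definition partial_sum x (i : nat) : 'rV[R]_d := \sum_(j < N | (j < i)%N) x j.

Definition walk_points x : 'M[R]_(n, d) := \matrix_(p, l) partial_sum x p 0 l.

(** The steps of the walk closed up into a cycle: row [0] is the step leading
    back from the last point to the origin. *)
Definition walk_increments x : 'M[R]_(n, d) := cyclic_increments (walk_points x).

Lemma partial_sumS x (j : 'I_N) : partial_sum x j.+1 = partial_sum x j + x j.
Proof.
rewrite /partial_sum (bigD1 j) //= addrC; congr (_ + _); apply: eq_bigl => i.
by rewrite ltnS ltn_neqAle andbC -val_eqE.
Qed.

Lemma walk_increments_lift x (j : 'I_N) l : walk_increments x (lift ord0 j) l = x j 0 l.
Proof.
have pj : ord_pred (lift ord0 j) = j :> nat.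
  rewrite (_ : nat_of_ord (ord_pred _) = ((j.+1 + n).-1 %% n)%N) // addSn /=.
  by rewrite modnDr modn_small // ltnW // ltnS.
rewrite !mxE pj -[nat_of_ord (lift _ _)]/(j.+1) partial_sumS mxE.
by rewrite addrAC subrr add0r.
Qed.

Lemma walk_increments0 x l : walk_increments x ord0 l = - \sum_j x j 0 l.
Proof.
have p0 : ord_pred (ord0 : 'I_n) = N :> nat.
  by rewrite (_ : nat_of_ord (ord_pred _) = (N %% n)%N) // modn_small.
rewrite !mxE p0 /partial_sum big_pred0 // mxE sub0r summxE.
by congr (- _); apply: eq_bigl => j; rewrite ltn_ord.
Qed.

Lemma walk_increments_perm x (s : {perm 'I_N}) :
  walk_increments (x \o s) = row_perm (lift_perm ord0 ord0 s) (walk_increments x).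
Proof.
apply/matrixP => p l; rewrite [RHS]mxE; case: (unliftP ord0 p) => [j ->|->].
  by rewrite lift_perm_lift !walk_increments_lift.
rewrite lift_perm_id !walk_increments0; congr (- _).
by rewrite [RHS](reindex_inj (@perm_inj _ s)).
Qed.

Lemma free_orthogonal (u : 'I_d -> 'rV[R]_d) (c : 'cV[R]_d) :
  free [tuple u a | a < d] -> (forall a, (u a *m c) 0 0 = 0) -> c = 0.
Proof.
move=> fu hc; pose g : 'Hom('rV[R]_d, 'rV[R]_1) := linfun (mulmxr c).
have sub : (<<[tuple u a | a < d]>> <= lker g)%VS.
  apply/span_subvP => _ /mapP[a _ ->]; rewrite memv_ker lfunE /=.
  by apply/eqP/matrixP => i j; rewrite !ord1 hc mxE.
have full : (fullv <= lker g)%VS.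
  apply: subv_trans sub; rewrite -(geq_leqif (dimv_leqif_sup (subvf _))).
  by rewrite (eqnP fu) size_tuple dimvf /dim /= mul1n.
apply/matrixP => l j; rewrite !ord1 [RHS]mxE.
have := subvP full (delta_mx 0 l) (memvf _); rewrite memv_ker lfunE /= -rowE => /eqP.
by move/matrixP => /(_ 0 0); rewrite !mxE.
Qed.

(** General position of all reordered walks: list the increments class after
    class, starting with [d] classes that avoid the closing step; the partial sums
    at the ends of these classes form a basis, and a dual vector killing the class
    sums kills all of them. *)
Lemma generic_walk x : (d <= N)%N ->
  (forall (s : {perm 'I_N}) (t : 'I_d -> nat),
     (forall a, (0 < t a <= N)%N) -> {homo t : a b / (a < b)%N} ->
     free [tuple partial_sum (x \o s) (t a) | a < d]) ->
  generic_classes (walk_increments x).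
Proof.
move=> dN gp phi c hphi hc.
pose C := ([set phi i | i : 'I_n] :\ phi ord0)%SET.
have C_d : (d <= #|C|)%N.
  have h0 : phi ord0 \in [set phi i | i : 'I_n]%SET by apply/imsetP; exists ord0.
  by move: hphi; rewrite (cardsD1 (phi ord0)) h0 add1n ltnS.
pose l := take d (enum C).
have ul : uniq l by rewrite take_uniq ?enum_uniq.
have sl : size l = d by rewrite size_take -cardE; case: ltngtP C_d.
have lC v : v \in l -> v \in C by move/mem_take; rewrite mem_enum.
pose g (j : 'I_N) := index (phi (lift ord0 j)) l.
have [s _ hs] := block_sort (fun=> tt) (fun j => - (g j)%:R : R).
have gs (p q : 'I_N) : (p <= q)%N -> (g (s p) <= g (s q))%N.
  rewrite leq_eqVlt => /predU1P[/val_inj -> //|pq].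
  by have := hs p q erefl pq; rewrite lerN2 ler_nat.
pose t (a : 'I_d) := #|[set p | (g (s p) <= a)%N]%SET|.
have tP a (p : 'I_N) : (p < t a)%N = (g (s p) <= a)%N.
  rewrite -mem_initial_segment ?inE // => p' q /gs h; rewrite !inE; exact: leq_trans.
have ex (a : 'I_d) : exists p, g (s p) = a.
  have al : (a < size l)%N by rewrite sl.
  have := lC _ (mem_nth ord0 al); rewrite !inE => /andP[ne /imsetP[i _ hi]].
  have [j ij] : exists j, i = lift ord0 j.
    case: (unliftP ord0 i) => [j ->|i0]; first by exists j.
    by rewrite hi i0 eqxx in ne.
  by exists ((s^-1)%g j); rewrite permKV /g -ij -hi index_uniq.
have t_bounds a : (0 < t a <= N)%N.
  apply/andP; split; last by rewrite -[X in (_ <= X)%N]card_ord max_card.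
  by have [p hp] := ex a; apply/card_gt0P; exists p; rewrite inE hp.
have t_incr : {homo t : a b / (a < b)%N}.
  move=> a b ab; have [p hp] := ex b.
  by have := tP a p; have := tP b p; rewrite hp leqnn (leqNgt b) ab /=; lia.
have fr := gp s t t_bounds t_incr.
apply: (free_orthogonal fr) => a.
pose F j := (walk_increments x *m c) (lift ord0 j) 0.
have Fx j : (x j *m c) 0 0 = F j.
  by rewrite /F mxE [RHS]mxE; apply: eq_bigr => i _; rewrite walk_increments_lift.
have -> : (partial_sum (x \o s) (t a) *m c) 0 0 = \sum_(j | (g j <= a)%N) F j.
  rewrite mulmx_suml summxE [RHS](reindex_inj (@perm_inj _ s)) /=.
  by apply: eq_big => [p|p _]; rewrite ?tP // Fx.
rewrite (partition_big (fun j => inord (g j) : 'I_d.+1) (fun v => (v <= a)%N)) /=; last first.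
  by move=> j ja; rewrite inordK // ltnS (leq_trans ja) // ltnW.
apply: big1 => v va.
have vd : (v < size l)%N by rewrite sl (leq_ltn_trans va).
pose cl := nth ord0 l v.
have := hc cl; rewrite big_mkcond big_ord_recl.
have -> : (phi ord0 == cl) = false.
  by have := lC _ (mem_nth ord0 vd); rewrite !inE => /andP[/negbTE h _]; rewrite eq_sym.
rewrite /= add0r -big_mkcond => h; rewrite -[RHS]h; apply: eq_bigl => j.
have -> : (g j <= a)%N && (inord (g j) == v) = (g j == v :> nat).
  have gd : (g j < d.+1)%N by rewrite ltnS -sl index_size.
  rewrite -val_eqE /= inordK //; case: eqP => [->|_]; rewrite ?andbF ?va //.
rewrite /g /cl; apply/eqP/eqP => [gv|->]; last by rewrite index_uniq.
by rewrite -gv nth_index // -index_mem gv.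
Qed.

End Walks.

(** * Rotations of cyclic orders *)

Section Rotations.
Variable N : nat.
Local Notation n := N.+1.
Implicit Types (r p q : 'I_n) (I J : {set 'I_n}).

Definition rotation r : {perm 'I_n} := perm (@addrI _ r).
Definition rotate_set r I : {set 'I_n} := [set r + p | p in I]%SET.

Lemma mem_rotate_set r I p : (p \in rotate_set r I) = (- r + p \in I).
Proof.
apply/imsetP/idP => [[q qI ->]|h]; first by rewrite addKr.
by exists (- r + p); rewrite ?addNKr.
Qed.

Lemma rotate_setK r : cancel (rotate_set r) (rotate_set (- r)).
Proof. by move=> I; apply/setP => p; rewrite !mem_rotate_set opprK addKr. Qed.

Lemma rotate_setNK r : cancel (rotate_set (- r)) (rotate_set r).
Proof. by move=> I; apply/setP => p; rewrite !mem_rotate_set opprK addNKr. Qed.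

Lemma card_rotate_set r I : #|rotate_set r I| = #|I|.
Proof. by rewrite card_imset //; apply: addrI. Qed.

Lemma ordS_add r p : ordS (r + p) = r + ordS p.
Proof.
apply: val_inj => /=.
by rewrite modnDmr -[in LHS]addn1 modnDml addn1 addnS.
Qed.

(** Every cyclic order of the increments meets position [0] once, so a
    rotation-invariant sum over walks with marked points is a sum over cyclic
    orders whose last position is marked, each counted once per mark. *)
Lemma sum_rotations k (F : {perm 'I_n} -> {set 'I_n} -> nat) :
  (forall r s I, F (rotation r * s)%g I = F s (rotate_set r I)) ->
  (k * \sum_(s : {perm 'I_N}) \sum_(I : {set 'I_n} | #|I| == k) F (lift_perm ord0 ord0 s) I =
  \sum_(s : {perm 'I_n}) \sum_(I : {set 'I_n} | (#|I| == k) && (ord_max \in I)) F s I)%N.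
Proof.
move=> hF.
rewrite [RHS](partition_big (fun s : {perm 'I_n} => (s^-1)%g ord0) predT) //=.
have -> : (\sum_(s : {perm 'I_N}) \sum_(I : {set 'I_n} | #|I| == k) F (lift_perm ord0 ord0 s) I =
   \sum_(s : {perm 'I_n} | s ord0 == ord0) \sum_(I : {set 'I_n} | #|I| == k) F s I)%N.
  rewrite [RHS](reindex (lift_perm ord0 ord0)) /=.
    by apply: eq_bigl => s; rewrite lift_perm_id eqxx.
  pose ulsf (s : {perm 'I_n}) j := odflt j (unlift (s ord0) (s (lift ord0 j))).
  have ulsfK (s : {perm 'I_n}) j : lift (s ord0) (ulsf s j) = s (lift ord0 j).
    rewrite /ulsf; have := neq_lift ord0 j.
    by rewrite -(can_eq (permK s)) => /unlift_some[] ? ? ->.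
  have inj_ulsf (s : {perm 'I_n}) : injective (ulsf s).
    move=> j j' h; apply: (@lift_inj _ ord0); apply: (@perm_inj _ s).
    by rewrite -!ulsfK h.
  exists (fun s => perm (inj_ulsf s)) => [s _ | s].
    by apply/permP => j; rewrite permE /ulsf lift_perm_lift lift_perm_id liftK.
  rewrite inE => /eqP s0; apply/permP => p; case: (unliftP ord0 p) => [j|] ->.
    by rewrite lift_perm_lift permE -{1}s0 ulsfK.
  by rewrite lift_perm_id s0.
transitivity (\sum_(q : 'I_n) \sum_(s : {perm 'I_n} | s ord0 == ord0)
    \sum_(I : {set 'I_n} | (#|I| == k) && ((- q + ord_max)%R \in I)) F s I)%N.
  rewrite [RHS]exchange_big big_distrr /=; apply: eq_bigr => s _.
  under [RHS]eq_bigr do rewrite big_mkcondr.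
  rewrite [RHS]exchange_big big_distrr /=; apply: eq_bigr => I /eqP Ik.
  rewrite -big_mkcond sum_nat_const; congr (_ * _)%N.
  have inj : injective (fun q : 'I_n => - q + ord_max).
    by move=> x y /addIr /oppr_inj.
  by rewrite -Ik -(card_preimset I inj) cardsE; apply: eq_card => q; rewrite -!topredE /=.
apply: eq_bigr => q _.
rewrite [RHS](reindex_inj (mulgI (rotation (- q)))) /=.
apply: eq_big => [s|s _].
  by rewrite (can2_eq (permKV _) (permK _)) permM permE addNr eq_sym.
rewrite [RHS](reindex (rotate_set q)) /=; last first.
  by exists (rotate_set (- q)) => I _; rewrite ?rotate_setK ?rotate_setNK.
by apply: eq_big => [I|I _]; rewrite ?card_rotate_set ?mem_rotate_set // hF rotate_setK.
Qed.

Section Descents.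
Variables (R : realType) (d : nat).
Implicit Types Y : 'M[R]_(n, d).

Lemma descent_rotation1 Y r I :
  cyclic_descent Y (rotate_set r I) -> cyclic_descent (row_perm (rotation r) Y) I.
Proof.
move=> [a aY ha]; exists (col_perm (rotation r) a).
  by rewrite col_permE row_permE mulmxA -(mulmxA a) -perm_mxM mulVg perm_mx1 mulmx1.
move=> p pI; rewrite !mxE !permE -ordS_add; apply: ha.
by rewrite mem_rotate_set addKr.
Qed.

Lemma descent_rotation Y r I :
  cyclic_descent (row_perm (rotation r) Y) I <-> cyclic_descent Y (rotate_set r I).
Proof.
split; last exact: descent_rotation1.
rewrite -{1}(rotate_setK r I) => /descent_rotation1.
rewrite -row_permM (_ : (rotation (- r) * rotation r)%g = 1%g) ?row_perm1 //.
by apply/permP => p; rewrite permM !permE addNKr.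
Qed.

(** Blocks end at the marks [I] and are numbered from left to right. *)
Definition block_of I p : nat := #|[set i in I | (i < p)%N]%SET|.

Lemma block_ofS I p q : (p < q)%N -> block_of I p = block_of I q ->
  forall i, i \in I -> (p <= i)%N -> (q <= i)%N.
Proof.
move=> pq h i iI pi; rewrite leqNgt; apply/negP => iq.
suff : (block_of I p < block_of I q)%N by rewrite h ltnn.
apply: proper_card; apply/properP; split.
  by apply/fintype.subsetP => j; rewrite !inE => /andP[-> /ltn_trans ->].
by exists i; rewrite !inE iI ?iq // -leqNgt.
Qed.

(** With a mark at the last position, no block passes through position [0], so
    that a cyclic descent is a descent along every block. *)
Lemma cyclic_descent_blocks Y I : ord_max \in I ->
  cyclic_descent Y I <-> descends (block_of I) Y.
Proof.
move=> maxI; split=> -[a aY ha]; exists a => //.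
  move=> p q + pq; have [m hm] : exists m, (q = p + m.+1 :> nat)%N.
    by exists (q - p.+1)%N; lia.
  elim: m q hm {pq} => [|m IH] q hm bpq.
    have -> : q = ordS p.
      by have qn := ltn_ord q; apply: val_inj => /=; rewrite modn_small; lia.
    apply: ha; apply/negP => pI.
    by have := block_ofS (_ : p < q)%N bpq pI (leqnn _); rewrite hm; lia.
  have qn := ltn_ord q.
  have rn : (p + m.+1 < n)%N by lia.
  pose r := Ordinal rn.
  have rI : r \notin I.
    apply/negP => rI; have : (p < q)%N by lia.
    by move=> /(block_ofS (I := I)) /(_ bpq _ rI) /=; lia.
  have qr : q = ordS r.
    by apply: val_inj => /=; rewrite modn_small; lia.
  apply: (@lt_trans _ _ (a 0 r)); first by rewrite qr ha.
  apply: IH => //.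
  apply/eqP; rewrite eqn_leq; apply/andP; split.
    by apply: subset_leq_card; apply/fintype.subsetP => j; rewrite !inE => /andP[-> /=]; lia.
  rewrite bpq; apply: subset_leq_card; apply/fintype.subsetP => j; rewrite !inE /=; lia.
move=> p pI; have pmax : p != ord_max by apply: contraNneq pI => ->.
have pN : (p < N)%N by rewrite ltn_neqAle -ltnS ltn_ord andbT; exact: pmax.
have Sp : ordS p = p.+1 :> nat by rewrite /= modn_small // ltnS.
apply: ha; last by rewrite Sp.
congr #|pred_of_set _|; apply/setP => i; rewrite !inE Sp ltnS [in RHS]leq_eqVlt.
case: eqP => [/val_inj -> /=|//]; by rewrite (negbTE pI).
Qed.

End Descents.

Lemma block_of_lt I p : ord_max \in I -> (block_of I p < #|I|)%N.
Proof.
move=> maxI; apply: proper_card; apply/properP; split.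
  by apply/fintype.subsetP => j; rewrite inE => /andP[].
by exists ord_max; rewrite // inE maxI -leqNgt -ltnS ltn_ord.
Qed.

Definition block_size I (b : nat) : nat := #|[set p | block_of I p == b]%SET|.

Lemma block_weight_sizes (R : realFieldType) I (t : R) : ord_max \in I ->
  block_weight (block_of I) t (enum 'I_n) =
  \prod_(b < #|I|) \prod_(l < block_size I b) (t + l%:R).
Proof.
move=> maxI.
have -> : \prod_(b < #|I|) \prod_(l < block_size I b) (t + l%:R) =
    \prod_(b < #|I|) \prod_(l < count (fun p => block_of I p == b) (enum 'I_n)) (t + l%:R).
  apply: eq_bigr => b _; suff -> : block_size I b = count (fun p => block_of I p == b) (enum 'I_n) by [].
  by rewrite /block_size -sum1dep_card -sum1_count big_enum_cond.
elim: (enum _) => [|e s IH] /=; first by rewrite big1 // => b _; rewrite big_ord0.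
rewrite IH; pose b0 := Ordinal (block_of_lt e maxI).
rewrite [RHS](bigD1 b0) // [X in _ * X = _](bigD1 b0) //= eqxx add1n big_ord_recr /=.
rewrite !mulrA [X in _ = X * _]mulrC; congr (_ * _); apply: eq_bigr => b bb0.
have -> : (block_of I e == b) = false by apply: contraNF bb0 => /eqP h; apply/eqP/val_inj.
by rewrite add0n.
Qed.

End Rotations.

(** * Estimates for rising factorials *)

Section Weights.
Variable R : realType.
Implicit Types (t : R) (m M : nat).

(** [t (t + 1) ... (t + m - 1) / m!], the weight of a block of size [m] relative
    to the number of its orders. *)
Definition rising_ratio t m : R := \prod_(l < m) ((t + l%:R) / (1 + l%:R)).

Lemma rising_ratio_gt0 t m : 0 < t -> 0 < rising_ratio t m.
Proof. by move=> t0; apply: prodr_gt0 => l _; rewrite divr_gt0 // ltr_wpDr. Qed.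

Lemma rising_ratioS t m : rising_ratio t m.+1 = rising_ratio t m * ((t + m%:R) / (1 + m%:R)).
Proof. by rewrite /rising_ratio big_ord_recr. Qed.

Lemma ln_le_sub1 (y : R) : 0 < y -> ln y <= y - 1.
Proof.
move=> y0; have h : -1 < y - 1 by lra.
have := le_ln1Dx h; by rewrite (_ : 1 + (y - 1) = y) //; ring.
Qed.

Lemma ln_succ m : (0 < m)%N -> (m.+1%:R : R)^-1 <= ln m.+1%:R - ln m%:R.
Proof.
move=> m0; have m0' : (0 : R) < m%:R by rewrite ltr0n.
have h : 0 < (m%:R : R) / m.+1%:R by rewrite divr_gt0.
have := ln_le_sub1 h; rewrite ln_div ?posrE // => hh.
have -> : (m.+1%:R : R)^-1 = 1 - m%:R / m.+1%:R.
  have nz : (m.+1%:R : R) != 0 by [].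
  by apply: (mulIf nz); rewrite mulVf // mulrBl mul1r divfK // -natrB // subSnn.
move: hh; set a := ln _; set b := ln _; set q := _ / _; lra.
Qed.

Lemma rising_ratio_le t m : 0 <= t -> (0 < m)%N ->
  rising_ratio (1 + t) m <= expR (t * (1 + ln m%:R)).
Proof.
move=> t0; case: m => // m _; elim: m => [|m IH].
  by rewrite rising_ratioS /rising_ratio big_ord0 ln1 addr0 mul1r !addr0 divr1 mulr1 expR_ge1Dx.
rewrite rising_ratioS.
have -> : t * (1 + ln m.+2%:R) = t * (1 + ln m.+1%:R) + t * (ln m.+2%:R - ln m.+1%:R).
  by ring.
rewrite expRD; apply: ler_pM => //.
- by rewrite ltW // rising_ratio_gt0 // ltr_pwDl.
- by rewrite divr_ge0 // !addr_ge0.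
have -> : (1 + t + m.+1%:R) / (1 + m.+1%:R) = 1 + t * (m.+2%:R)^-1 :> R.
  by rewrite addrAC mulrDl -(natrD _ 1) divff.
apply: le_trans (expR_ge1Dx _) _; rewrite ler_expR ler_wpM2l // ln_succ //.
Qed.

(** A linear upper bound of the logarithm, so that the sum over blocks only
    depends on the total size. *)
Lemma rising_ratio_le_linear t m (a : R) : 1 <= t -> 1 <= a ->
  rising_ratio t m <= expR ((t - 1) * (m%:R / a + ln a)).
Proof.
move=> t1 a1; have a0 : 0 < a by apply: lt_le_trans a1.
have t0 : 0 <= t - 1 by rewrite subr_ge0.
case: m => [|m].
  by rewrite /rising_ratio big_ord0 -[leLHS]expR0 ler_expR mulr_ge0 // mul0r add0r ln_ge0.
have := rising_ratio_le t0 (ltn0Sn m); rewrite addrCA subrr addr0 => /le_trans; apply.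
rewrite ler_expR ler_wpM2l //.
have h : 0 < (m.+1%:R : R) / a by rewrite divr_gt0.
have := ln_le_sub1 h; rewrite ln_div ?posrE //; lra.
Qed.

Lemma sum_rising_ratio t M : \sum_(m < M.+1) rising_ratio t m = rising_ratio (1 + t) M.
Proof.
have shift m : rising_ratio t m.+1 = t / m.+1%:R * rising_ratio (1 + t) m.
  elim: m => [|m IH].
    by rewrite rising_ratioS /rising_ratio !big_ord0 !addr0 mul1r mulr1.
  rewrite rising_ratioS IH (rising_ratioS (1 + t)).
  have h1 : (m.+1%:R : R) != 0 by [].
  have h2 : (m.+2%:R : R) != 0 by [].
  have e1 : (1 + m.+1%:R : R) = m.+2%:R by rewrite -(natrD _ 1).
  have e2 : (1 + m%:R : R) = m.+1%:R by rewrite -(natrD _ 1).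
  have e3 : (1 + t + m%:R : R) = t + m.+1%:R by rewrite -e2; ring.
  rewrite e1 e2 e3; set x := rising_ratio _ _.
  move: h1 h2; set a : R := m.+1%:R; set b : R := m.+2%:R => h1 h2.
  by field; apply/andP.
elim: M => [|M IH]; first by rewrite big_ord_recl big_ord0 addr0 /rising_ratio !big_ord0.
rewrite big_ord_recr /= IH shift rising_ratioS.
have h1 : (M.+1%:R : R) != 0 by [].
have e2 : (1 + M%:R : R) = M.+1%:R by rewrite -(natrD _ 1).
have e3 : (1 + t + M%:R : R) = t + M.+1%:R by rewrite -e2; ring.
by rewrite e2 e3 mulrDl divff // mulrDr mulr1 addrC [X in X + _]mulrC.
Qed.

Lemma rising_ratio_decr t m M : 0 < t <= 1 -> (m <= M)%N ->
  rising_ratio t M <= rising_ratio t m.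
Proof.
move=> /andP[t0 t1] /subnK <-; elim: (M - m)%N => // j IH.
rewrite addSn rising_ratioS; apply: le_trans IH; apply: ler_piMr.
  by rewrite ltW // rising_ratio_gt0.
by rewrite ler_pdivrMr ?mul1r ?lerD2r // ltr_wpDr.
Qed.

Lemma geometric_sum_le (r : R) m : 0 <= r < 1 -> \sum_(i < m) r ^+ i <= (1 - r)^-1.
Proof.
move=> /andP[r0 r1]; have h : 0 < 1 - r by rewrite subr_gt0.
rewrite -[leRHS]mul1r ler_pdivlMr //.
have -> : (\sum_(i < m) r ^+ i) * (1 - r) = 1 - r ^+ m.
  elim: m => [|m IH]; first by rewrite big_ord0 mul0r expr0 subrr.
  by rewrite big_ord_recr mulrDl IH exprS /=; ring.
by rewrite gerBl exprn_ge0.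
Qed.

(** Splitting at [n / k], the mean block size: below it the sum is explicit,
    beyond it the weights decrease and the geometric factor takes over. *)
Lemma weighted_sum_le t (n k : nat) : 0 < t <= 1 -> (0 < k <= n)%N ->
  \sum_(m < n.+1) rising_ratio t m * (1 - k%:R / n%:R) ^+ m <=
  2 * expR (t * (1 + ln (n%:R / k%:R))).
Proof.
move=> /andP[t0 t1] /andP[k0 kn].
have n0 : (0 : R) < n%:R by rewrite ltr0n; lia.
have k0' : (0 : R) < k%:R by rewrite ltr0n.
have q1 : (1 : R) <= n%:R / k%:R by rewrite ler_pdivlMr // mul1r ler_nat.
set r : R := 1 - _.
have kn1 : (k%:R : R) / n%:R <= 1 by rewrite ler_pdivrMr // mul1r ler_nat.
have r0 : 0 <= r by rewrite subr_ge0.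
have r1 : r < 1 by rewrite gtrBl divr_gt0.
pose M := Num.truncn (n%:R / k%:R : R).
have Mle : M%:R <= (n%:R / k%:R : R) by rewrite truncn_le // (le_trans ler01).
have Mgt : (n%:R / k%:R : R) < M.+1%:R by apply: truncnS_gt.
have M1 : (0 < M)%N by rewrite -ltnS -(ltr_nat R); apply: le_lt_trans Mgt.
have Mn : (M <= n)%N.
  rewrite -(ler_nat R); apply: le_trans Mle _.
  by rewrite ler_pdivrMr // ler_peMr // ler1n.
have c_ge0 m : 0 <= rising_ratio t m by rewrite ltW // rising_ratio_gt0.
have SM : rising_ratio t M * M.+1%:R <= rising_ratio (1 + t) M.
  rewrite -sum_rising_ratio mulr_natr -[in X in _ *+ X](card_ord M.+1) -sumr_const.
  by apply: ler_sum => m _; rewrite rising_ratio_decr ?t0 // -ltnS.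
apply: (@le_trans _ _ (rising_ratio (1 + t) M + rising_ratio t M * (n%:R / k%:R))).
  apply: (@le_trans _ _ (\sum_(m < n.+1) ((if (m < M.+1)%N then rising_ratio t m else 0)
     + rising_ratio t M * r ^+ m))).
    apply: ler_sum => m _; case: ltnP => hm.
      rewrite -[leLHS]addr0 lerD //.
        by rewrite ler_piMr // exprn_ile1 // ltW.
      by rewrite mulr_ge0 // exprn_ge0.
    rewrite add0r ler_wpM2r ?exprn_ge0 // rising_ratio_decr ?t0 // ltnW //.
  rewrite big_split /= -big_mkcond -(big_ord_widen n.+1 (rising_ratio t)) //.
  rewrite sum_rising_ratio lerD2l -mulr_sumr ler_wpM2l //.
  apply: le_trans (geometric_sum_le _ _) _; first by rewrite r0.
  by rewrite /r opprB addrCA subrr addr0 invf_div.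
have step : rising_ratio t M * (n%:R / k%:R) <= rising_ratio (1 + t) M.
  by apply: le_trans SM; rewrite ler_wpM2l // ltW.
apply: (@le_trans _ _ (2 * rising_ratio (1 + t) M)); first by rewrite mulrDl !mul1r lerD2l.
rewrite ler_pM2l //; apply: le_trans (rising_ratio_le (ltW t0) M1) _.
by rewrite ler_expR ler_pM2l // lerD2l ler_ln ?posrE ?ltr0n // (lt_le_trans ltr01).
Qed.

End Weights.

Lemma bin_ge (n k : nat) : (k <= n)%N -> (n ^ k <= 'C(n, k) * k ^ k)%N.
Proof.
move=> kn; have h j : (j <= k)%N -> (k ^_ j * n ^ j <= n ^_ j * k ^ j)%N.
  elim: j => // j IH jk; rewrite !ffactnSr !expnSr.
  rewrite mulnACA [X in (_ <= X)%N]mulnACA; apply: leq_mul; first exact: IH (ltnW jk).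
  by rewrite !mulnBl mulnC leq_sub2l // leq_mul2l kn orbT.
have := h k (leqnn _); rewrite ffactnn -bin_ffact -mulnA [(k`! * _)%N in X in (_ <= X)%N]mulnC.
by rewrite [(k`! * _)%N]mulnC mulnA leq_pmul2r // fact_gt0.
Qed.

(** * Counting descents of reordered walks *)

Section MarkedSets.
Variables (R : realType) (N k : nat).
Local Notation n := N.+1.
Implicit Types (I : {set 'I_n}) (t : R).

(** Marks splitting a cyclic order into [k] blocks; the mark at the last position
    prevents a block from wrapping around. *)
Definition marked I : bool := (#|I| == k) && (ord_max \in I).

Definition block_product t I : R := \prod_(b < k) rising_ratio t (block_size I b).

Lemma block_productE t I : marked I -> 0 < t ->
  block_weight (block_of I) t (enum 'I_n) / block_weight (block_of I) 1 (enum 'I_n) =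
  block_product t I.
Proof.
move=> /andP[/eqP Ik maxI] t0.
rewrite !block_weight_sizes // Ik -prodf_div; apply: eq_bigr => b _.
by rewrite -prodf_div.
Qed.

Lemma sum_block_size I : marked I -> (\sum_(b < k) block_size I b = n)%N.
Proof.
move=> /andP[/eqP Ik maxI]; rewrite -[RHS](card_ord n) -sum1_card.
have lt p : (block_of I p < k)%N by rewrite -Ik block_of_lt.
rewrite (partition_big (fun p => Ordinal (lt p)) predT) //=; apply: eq_bigr => b _.
by rewrite /block_size -sum1dep_card; apply: eq_bigl => p; rewrite -val_eqE.
Qed.

Lemma card_block_le I b :
  #|[set p | (block_of I p <= b)%N]%SET| = (\sum_(i < b.+1) block_size I i)%N.
Proof.
rewrite -sum1dep_card.
rewrite (partition_big (fun p => inord (block_of I p) : 'I_b.+1) predT) //=.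
apply: eq_bigr => i _; rewrite /block_size -sum1dep_card; apply: eq_bigl => p.
rewrite -val_eqE /=; case: leqP => h /=; first by rewrite inordK.
by apply/esym/negbTE; rewrite neq_ltn (leq_trans (ltn_ord i) h) orbT.
Qed.

(** Partial sums of the block sizes give the positions of the marks. *)
Lemma block_size_inj I I' : marked I -> marked I' ->
  (forall b, (b < k)%N -> block_size I b = block_size I' b) -> I = I'.
Proof.
move=> mI mI' hb.
have seg (J : {set 'I_n}) b p : (block_of J p <= b)%N = (p < \sum_(i < b.+1) block_size J i)%N.
  rewrite -card_block_le -mem_initial_segment ?inE // => q q' qq; rewrite !inE.
  apply: leq_trans; apply: subset_leq_card; apply/fintype.subsetP => j.
  by rewrite !inE => /andP[-> /=] /leq_trans; apply.
have lt (J : {set 'I_n}) p : marked J -> (block_of J p < k)%N.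
  by move=> /andP[/eqP <- maxJ]; apply: block_of_lt.
have eqle b p : (b < k)%N -> (block_of I p <= b)%N = (block_of I' p <= b)%N.
  move=> bk; rewrite !seg; congr (_ < _)%N; apply: eq_bigr => i _; apply: hb.
  by apply: leq_trans bk; apply: ltn_ord.
have eqb p : block_of I p = block_of I' p.
  apply/eqP; rewrite eqn_leq eqle ?lt // leqnn /=.
  by rewrite -eqle ?lt // leqnn.
have mem (J : {set 'I_n}) p : marked J -> (p \in J) =
    ((p == ord_max) || (block_of J p != block_of J (ordS p))).
  move=> /andP[_ maxJ]; case: eqVneq => [->|pmax] /=; first by rewrite maxJ.
  have pN : (p < N)%N by rewrite ltn_neqAle -ltnS ltn_ord andbT; exact: pmax.
  have Sp : ordS p = p.+1 :> nat by rewrite /= modn_small // ltnS.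
  apply/idP/idP => [pJ|].
    apply/eqP => h; have := block_ofS (_ : p < ordS p)%N h pJ (leqnn _).
    by rewrite Sp ltnn => /(_ (ltnSn _)).
  apply: contraR => pJ; apply/eqP; congr #|pred_of_set _|.
  apply/setP => i; rewrite !inE Sp ltnS [in RHS]leq_eqVlt.
  by case: eqP => [/val_inj -> /=|//]; rewrite (negbTE pJ).
by apply/setP => p; rewrite !mem // !eqb.
Qed.

(** The geometric mean of the block sizes is at most [n / k]. *)
Lemma block_product_le t I : marked I -> (0 < k <= n)%N -> 1 <= t ->
  block_product t I <= expR ((t - 1) * (k%:R + k%:R * ln (n%:R / k%:R))).
Proof.
move=> mI /andP[k0 kn] t1.
have k0' : (0 : R) < k%:R by rewrite ltr0n.
have a1 : (1 : R) <= n%:R / k%:R by rewrite ler_pdivlMr // mul1r ler_nat.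
set a := n%:R / k%:R in a1 *.
apply: (@le_trans _ _ (\prod_(b < k) expR ((t - 1) * ((block_size I b)%:R / a + ln a)))).
  apply: ler_prod => b _; rewrite rising_ratio_le_linear // andbT.
  by rewrite ltW // rising_ratio_gt0 // (lt_le_trans ltr01).
rewrite -expR_sum ler_expR -mulr_sumr ler_wpM2l ?subr_ge0 // big_split /=.
rewrite -mulr_suml -natr_sum sum_block_size // sumr_const card_ord -[ln a *+ _]mulr_natl lerD2r.
by rewrite /a invf_div mulrCA divff ?mulr1 // gt_eqF // ltr0n.
Qed.

(** The block sizes determine the marks, so the sum over marked sets is
    dominated by a [k]-th power. *)
Lemma sum_block_product_le t : (0 < k <= n)%N -> 0 < t <= 1 ->
  (\sum_(I | marked I) block_product t I) * (1 - k%:R / n%:R) ^+ n <=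
  (2 * expR (t * (1 + ln (n%:R / k%:R)))) ^+ k.
Proof.
move=> kn t01; set r : R := 1 - _.
have r0 : 0 <= r.
  by case/andP: kn => _ kn; rewrite subr_ge0 ler_pdivrMr ?ltr0n // mul1r ler_nat.
pose w (m : nat) := rising_ratio t m * r ^+ m.
have w0 m : 0 <= w m.
  by case/andP: t01 => t0 _; rewrite mulr_ge0 ?exprn_ge0 // ltW // rising_ratio_gt0.
apply: (@le_trans _ _ ((\sum_(m < n.+1) w m) ^+ k)); last first.
  apply: lerXn2r; rewrite ?nnegrE ?sumr_ge0 ?mulr_ge0 ?expR_ge0 //.
  exact: weighted_sum_le.
have -> : (\sum_(m < n.+1) w m) ^+ k = \sum_(f : {ffun 'I_k -> 'I_n.+1}) \prod_b w (f b).
  by rewrite -(bigA_distr_bigA (fun=> fun m : 'I_n.+1 => w m)) prodr_const card_ord.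
pose sizes I : {ffun 'I_k -> 'I_n.+1} := [ffun b : 'I_k => inord (block_size I b)].
have size_lt I b : (block_size I b < n.+1)%N.
  by rewrite ltnS -[X in (_ <= X)%N](card_ord n); apply: max_card.
have sizes_inj : {in [pred I | marked I] &, injective sizes}.
  move=> I I' mI mI' /ffunP h; apply: block_size_inj => // b bk.
  have := h (Ordinal bk); rewrite !ffunE => /(congr1 val) /=.
  by rewrite !inordK.
have -> : (\sum_(I | marked I) block_product t I) * r ^+ n =
    \sum_(I | marked I) \prod_b w (sizes I b).
  rewrite mulr_suml; apply: eq_bigr => I mI.
  rewrite -[in LHS](sum_block_size mI) -prodrXr -big_split /=; apply: eq_bigr => b _.
  by rewrite ffunE /w inordK.
rewrite -(big_imset (fun f : {ffun 'I_k -> 'I_n.+1} => \prod_b w (f b)) sizes_inj) /=.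
rewrite [leRHS](bigID (mem (sizes @: [pred I | marked I]))) /=.
rewrite -[leLHS]addr0 lerD // ?sumr_ge0 // => f _; exact: prodr_ge0.
Qed.

End MarkedSets.

Section Counting.
Variables (R : realType) (N d k : nat).
Local Notation n := N.+1.
Implicit Types (x : 'I_N -> 'rV[R]_d) (t : R).

(** In general position: the number of pairs of an order of the steps and a set
    of [k] points of the reordered walk that do not span a face. *)
Definition descent_count x : nat :=
  \sum_(s : {perm 'I_N}) \sum_(I : {set 'I_n} | #|I| == k)
    `[< cyclic_descent (walk_increments (x \o s)) I >].

(** The rotation identity for a constant function. *)
Lemma card_marked :
  (k * (N`! * 'C(n, k)) = n`! * #|[set I : {set 'I_n} | marked k I]%SET|)%N.
Proof.
have := @sum_rotations N k (fun _ _ => 1%N) (fun _ _ _ => erefl).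
rewrite !sum1dep_card !sum_nat_const /= card_draws card_ord => h.
by rewrite -[in LHS](card_Sn N) -[in RHS](card_Sn n) -h.
Qed.

Lemma descent_count_marked x :
  (k * descent_count x = \sum_(I : {set 'I_n} | marked k I)
     #|[set s : {perm 'I_n} | `[< descends (block_of I) (row_perm s (walk_increments x)) >]]%SET|)%N.
Proof.
pose F (s : {perm 'I_n}) I : nat := `[< cyclic_descent (row_perm s (walk_increments x)) I >].
have hF r s I : F (rotation r * s)%g I = F s (rotate_set r I).
  by rewrite /F row_permM; congr nat_of_bool; apply: asbool_equiv_eq; apply: descent_rotation.
transitivity (k * \sum_(s : {perm 'I_N}) \sum_(I : {set 'I_n} | #|I| == k)
    F (lift_perm ord0 ord0 s) I)%N.
  congr (_ * _)%N; apply: eq_bigr => s _; apply: eq_bigr => I _.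
  by rewrite /F walk_increments_perm.
rewrite sum_rotations // exchange_big /=; apply: eq_bigr => I /andP[_ maxI].
rewrite -sum1dep_card [RHS]big_mkcond; apply: eq_bigr => s _.
rewrite /F (asbool_equiv_eq (cyclic_descent_blocks _ maxI)); by case: asbool.
Qed.

(** The bounds of [card_descends_le] and [card_descends_ge] for one marked set,
    summed over the marked sets by the rotation identity. *)
Lemma descent_count_le x t B : generic_classes (walk_increments x) ->
  (d <= N)%N -> (0 < k)%N -> 1 <= t ->
  (forall I : {set 'I_n}, marked k I -> block_product k t I <= B) ->
  (descent_count x)%:R * t ^+ d <= (N`! * 'C(n, k))%:R * B.
Proof.
move=> gY dN k0 t1 hB; have k0' : (0 : R) < k%:R by rewrite ltr0n.
have t0 : 0 < t by apply: lt_le_trans t1.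
rewrite -(ler_pM2l k0') !mulrA -!natrM card_marked descent_count_marked.
rewrite natr_sum mulr_suml natrM -mulrA -sum1dep_card natr_sum mulr_suml mulr_sumr.
apply: ler_sum => I mI; rewrite mul1r.
apply: le_trans (card_descends_le (block_of I) gY _ t1) _ => //.
by rewrite (block_productE mI) // ler_wpM2l // hB.
Qed.

Lemma descent_count_ge x t : generic_classes (walk_increments x) ->
  (d <= N)%N -> 0 < t <= 1 ->
  k%:R * ((N`! * 'C(n, k))%:R - (descent_count x)%:R) * t ^+ d.+1 <=
  n`!%:R * \sum_(I : {set 'I_n} | marked k I) block_product k t I.
Proof.
move=> gY dN t01; have /andP[t0 _] := t01.
rewrite mulrBr -!natrM card_marked descent_count_marked.
rewrite natrM -sum1dep_card !natr_sum mulr_sumr -sumrB mulr_suml mulr_sumr.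
apply: ler_sum => I mI; rewrite mulr1.
apply: le_trans (card_descends_ge (block_of I) gY _ t01) _ => //.
by rewrite (block_productE mI).
Qed.

End Counting.

(** * Faces of a polytope with vertices in general position *)

Section FacesOfHull.
Variables (R : realType) (N d : nat) (P : 'M[R]_(N.+1, d)).
Local Notation n := N.+1.
Local Open Scope classical_set_scope.
Local Open Scope ring_scope.
Implicit Types (I : {set 'I_n}) (F : set 'rV[R]_d).

Definition point_hull : set 'rV[R]_d :=
  smallest (@convex_set R 'rV[R]_d) [set row p P | p in [set: 'I_n]].

Definition convex_combination I : set 'rV[R]_d := [set x | exists a : 'I_n -> R,
  [/\ forall p, 0 <= a p, forall p, p \notin I -> a p = 0, \sum_p a p = 1
    & x = \sum_p a p *: row p P]].

Lemma point_in_hull p : point_hull (row p P).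
Proof. by move=> A [_]; apply; exists p. Qed.

Lemma hull_combination x : point_hull x ->
  exists a : 'I_n -> R, [/\ forall p, 0 <= a p, \sum_p a p = 1
    & x = \sum_p a p *: row p P].
Proof.
pose A : set 'rV[R]_d := [set x | exists a : 'I_n -> R,
  [/\ forall p, 0 <= a p, \sum_p a p = 1 & x = \sum_p a p *: row p P]].
move=> /(_ A); apply; split; last first.
  move=> _ [p _ <-]; exists (fun q => (q == p)%:R); split=> //.
    by rewrite (bigD1 p) //= eqxx big1 ?addr0 // => q /negbTE ->.
  rewrite (bigD1 p) //= eqxx scale1r big1 ?addr0 // => q /negbTE ->.
  by rewrite scale0r.
move=> x1 x2 l; rewrite !inE => -[a [a0 a1 ->]] [b [b0 b1 ->]].
have l0 : 0 <= l%:num by [].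
have l1 : 0 <= 1 - l%:num by rewrite subr_ge0 le1.
exists (fun p => l%:num * a p + (1 - l%:num) * b p); split.
- by move=> p; rewrite addr_ge0 // mulr_ge0.
- by rewrite big_split /= -!mulr_sumr a1 b1 !mulr1 addrC subrK.
- rewrite [LHS](_ : _ = l%:num *: (\sum_p a p *: row p P) +
     (1 - l%:num) *: (\sum_p b p *: row p P)) //.
  rewrite !scaler_sumr -big_split /=; apply: eq_bigr => p _.
  by rewrite !scalerA -scalerDl.
Qed.

Lemma combination_mul (a : 'I_n -> R) (c : 'cV[R]_d) :
  ((\sum_p a p *: row p P) *m c) 0 0 = \sum_p a p * (P *m c) p 0.
Proof.
rewrite mulmx_suml summxE; apply: eq_bigr => p _.
by rewrite -scalemxAl mxE -row_mul mxE.
Qed.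

Lemma row_mul00 p (c : 'cV[R]_d) : (row p P *m c) 0 0 = (P *m c) p 0.
Proof. by rewrite -row_mul mxE. Qed.

(** The vertices on a supporting hyperplane determine the face. *)
Lemma face_combination (c : 'cV[R]_d) (b : R) I :
  (forall x, point_hull x -> (x *m c) 0 0 <= b) ->
  (forall p, (p \in I) = ((P *m c) p 0 == b)) ->
  point_hull `&` [set x | (x *m c) 0 0 = b] = point_hull `&` convex_combination I.
Proof.
move=> hb hI; apply/seteqP; split=> x [Cx] /=; last first.
  move=> [a [a0 aI a1 xE]]; split => //; rewrite /= xE.
  rewrite combination_mul -[RHS]mul1r -a1 mulr_suml; apply: eq_bigr => p _.
  have [pI|/aI ->] := boolP (p \in I); last by rewrite !mul0r.
  by move: pI; rewrite hI => /eqP ->.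
move=> xb; split=> //; have [a [a0 a1 xE]] := hull_combination Cx.
exists a; split=> // p pI.
have le q : a q * (P *m c) q 0 <= a q * b.
  by rewrite ler_wpM2l // -row_mul00 hb //; apply: point_in_hull.
have : \sum_q (a q * b - a q * (P *m c) q 0) == 0.
  by rewrite sumrB -mulr_suml a1 mul1r -combination_mul -xE xb subrr.
rewrite psumr_eq0 => [/allP /(_ p (mem_index_enum _))|q _]; last by rewrite subr_ge0.
rewrite /= -mulrBr mulf_eq0 => /orP[/eqP //|]; rewrite subr_eq0 eq_sym -hI.
by rewrite (negbTE pI).
Qed.

Definition vertices F : {set 'I_n} := [set p | `[< F (row p P) >]]%SET.

Lemma mem_vertices (c : 'cV[R]_d) (b : R) p :
  (p \in vertices (point_hull `&` [set x | (x *m c) 0 0 = b])) = ((P *m c) p 0 == b).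
Proof.
rewrite inE -row_mul00; apply/asboolP/eqP => [[]//|h]; split => //.
exact: point_in_hull.
Qed.

Lemma face_vertices F : face point_hull F ->
  F = point_hull `&` convex_combination (vertices F).
Proof.
move=> [c [b [hb ->]]]; apply: face_combination => // p; exact: mem_vertices.
Qed.

Lemma face_exposed F : face point_hull F -> exposed P (vertices F).
Proof.
move=> [c [b [hb ->]]]; exists c, b => p; rewrite mem_vertices.
case: eqP => // /eqP ne; rewrite lt_neqAle ne -row_mul00 hb //.
exact: point_in_hull.
Qed.

Lemma exposed_face I : exposed P I ->
  face point_hull (point_hull `&` convex_combination I) /\
  vertices (point_hull `&` convex_combination I) = I.
Proof.
move=> [c [b hcb]].
have hb x : point_hull x -> (x *m c) 0 0 <= b.
  move=> /hull_combination[a [a0 a1 ->]]; rewrite combination_mul -[leRHS]mul1r -a1 mulr_suml.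
  apply: ler_sum => p _; rewrite ler_wpM2l //.
  by have := hcb p; case: ifP => _ => [->|/ltW].
have hI p : (p \in I) = ((P *m c) p 0 == b).
  by have := hcb p; case: ifP => _ => [->|/lt_eqF ->]; rewrite ?eqxx.
have <- := face_combination hb hI; split.
  by exists c, b.
by apply/setP => p; rewrite mem_vertices hI.
Qed.

Definition edge_space I (p0 : 'I_n) : {vspace 'rV[R]_d} :=
  <<[seq row p P - row p0 P | p <- enum I]>>%VS.

Lemma edge_in_space I p0 p : p \in I -> row p P - row p0 P \in edge_space I p0.
Proof.
by move=> pI; apply: memv_span; apply/mapP; exists p; rewrite ?mem_enum.
Qed.

Lemma affine_dim_face I p0 l : p0 \in I ->
  affine_dim (point_hull `&` convex_combination I) l <-> \dim (edge_space I p0) = l.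
Proof.
move=> p0I; set F := _ `&` _.
have inF p : p \in I -> F (row p P).
  move=> pI; split; first exact: point_in_hull.
  exists (fun q => (q == p)%:R); split=> //.
  - by move=> q qI; rewrite (_ : (q == p) = false) //; apply: contraNF qI => /eqP ->.
  - by rewrite (bigD1 p) //= eqxx big1 ?addr0 // => q /negbTE ->.
  - rewrite (bigD1 p) //= eqxx scale1r big1 ?addr0 // => q /negbTE ->.
    by rewrite scale0r.
have toW x : F x -> x - row p0 P \in edge_space I p0.
  move=> [_ [a [a0 aI a1 ->]]].
  have -> : \sum_p a p *: row p P - row p0 P = \sum_p a p *: (row p P - row p0 P).
    under [RHS]eq_bigr do rewrite scalerBr.
    by rewrite sumrB -scaler_suml a1 scale1r.
  apply: memv_suml => p _; have [pI|/aI ->] := boolP (p \in I).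
    by rewrite memvZ // edge_in_space.
  by rewrite scale0r mem0v.
split=> [[x0 [Fx0 [U [<- [hU minU]]]]]|<-].
  congr (\dim _); apply/eqP; rewrite eqEsubv; apply/andP; split.
    apply/span_subvP => _ /mapP[p + ->]; rewrite mem_enum => pI.
    have -> : row p P - row p0 P = (row p P - x0) - (row p0 P - x0).
      by rewrite opprB addrA subrK.
    by rewrite memvB // hU //; apply: inF.
  apply: minU => x Fx.
  have -> : x - x0 = (x - row p0 P) - (x0 - row p0 P) by rewrite opprB addrA subrK.
  by rewrite memvB // toW.
exists (row p0 P); split; first exact: inF.
exists (edge_space I p0); split=> //; split; first exact: toW.
move=> V hV; apply/span_subvP => _ /mapP[p + ->]; rewrite mem_enum => pI.
exact/hV/inF.
Qed.

Hypothesis gY : generic_classes (cyclic_increments P).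
Hypothesis dn : (d < n)%N.

(** The affine functions that separate one point of [I] from the others show
    that the edges issuing from [p0] are independent. *)
Lemma dim_edge_space I p0 : p0 \in I -> (#|I| <= d.+1)%N ->
  \dim (edge_space I p0) = #|I|.-1.
Proof.
move=> p0I Id; pose m := #|(I :\ p0)%SET|.
have mE : #|I|.-1 = m by rewrite /m [in LHS](cardsD1 p0) p0I.
pose X := [tuple row (enum_val a) P - row p0 P | a < m].
have spanX : edge_space I p0 = <<X>>%VS.
  apply/eqP; rewrite eqEsubv; apply/andP; split; apply/span_subvP => _ /mapP[p + ->].
    rewrite mem_enum => pI; have [->|pp0] := eqVneq p p0.
      by rewrite subrr mem0v.
    have pI' : p \in (I :\ p0)%SET by rewrite !inE pp0.
    apply: memv_span; apply/mapP; exists (enum_rank_in pI' p); rewrite ?mem_enum //.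
    by rewrite enum_rankK_in.
  move=> _; apply: edge_in_space.
  by have := enum_valP p; rewrite !inE => /andP[].
rewrite mE spanX; suff /eqnP -> : free X by rewrite size_tuple.
apply/freeP => y hy a.
have [c [b hcb]] := affine_interpolation (fun p => (p == enum_val a)%:R) gY dn Id.
have aI e : enum_val (A := (I :\ p0)%SET) e \in I.
  by have := enum_valP e; rewrite !inE => /andP[].
have ap0 e : (p0 == enum_val (A := (I :\ p0)%SET) e) = false.
  by have := enum_valP e; rewrite !inE => /andP[/negbTE h _]; rewrite eq_sym.
have hy' : \sum_(e < m) y e *: (row (enum_val e) P - row p0 P) = 0.
  by rewrite -[RHS]hy; apply: eq_bigr => e _; rewrite -tnth_nth tnth_mktuple.
have diff e : ((row (enum_val e) P - row p0 P) *m c) 0 0 = (e == a)%:R.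
  rewrite mulmxBl [(_ - _ : 'M[R]_(_, _)) _ _]mxE [(- _ : 'M[R]_(_, _)) _ _]mxE !row_mul00.
  have := hcb _ (aI e); have := hcb _ p0I; rewrite ap0 (inj_eq enum_val_inj) => h1 h2.
  by move: h1 h2 => /=; lra.
have := congr1 (fun v : 'rV[R]_d => (v *m c) 0 0) hy'.
rewrite /= mul0mx [RHS]mxE mulmx_suml summxE (bigD1 a) //= big1 ?addr0 => [|e ea].
  by rewrite -scalemxAl mxE diff eqxx mulr1.
by rewrite -scalemxAl mxE diff (negbTE ea) mulr0.
Qed.

(** Otherwise a nonzero functional would be constant on more than [d] points. *)
Lemma edge_space_full I p0 : p0 \in I -> (d < #|I|)%N -> edge_space I p0 = fullv.
Proof.
move=> p0I dI; pose M : 'M[R]_(n, d) := \matrix_(p, l) (if p \in I then P p l - P p0 l else 0).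
have rowM p : p \in I -> row p M = row p P - row p0 P.
  by move=> pI; apply/rowP => l; rewrite !mxE pI.
have full : row_full M.
  apply: row_full_inj => c Mc; apply/eqP; apply: contraLR dI => c0; rewrite -leqNgt.
  apply: leq_trans (card_on_hyperplane ((P *m c) p0 0) gY c0).
  apply: subset_leq_card; apply/fintype.subsetP => p pI; rewrite inE.
  have := congr1 (fun v : 'cV[R]_n => v p 0) Mc; rewrite /= [RHS]mxE.
  have -> : (M *m c) p 0 = (row p M *m c) 0 0 by rewrite -row_mul [RHS]mxE.
  rewrite rowM // mulmxBl [(_ - _ : 'M[R]_(_, _)) _ _]mxE [(- _ : 'M[R]_(_, _)) _ _]mxE !row_mul00.
  by move/eqP; rewrite subr_eq0.
apply/eqP; rewrite eqEsubv subvf /=; apply/subvP => v _.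
rewrite -(mulmxKpV (submx_full v full)) (mulmx_sum_row (v *m pinvmx M) M).
apply: memv_suml => p _; rewrite memvZ //; have [pI|pI] := boolP (p \in I).
  by rewrite rowM // edge_in_space.
suff -> : row p M = 0 by rewrite mem0v.
by apply/rowP => l; rewrite !mxE (negbTE pI).
Qed.

(** In general position every face of dimension less than [d] is a simplex,
    so that the faces of dimension [k - 1] are the exposed [k]-sets. *)
Lemma nfaces_exposed k : (0 < k <= d)%N ->
  nfaces k.-1 point_hull = #|[set I : {set 'I_n} | (#|I| == k) && `[< exposed P I >]]%SET|.
Proof.
move=> /andP[k0 kd]; set E := finset _.
pose psi I := point_hull `&` convex_combination I.
have psi_inj : {in E &, injective psi}.
  move=> I J; rewrite !inE => /andP[_ /asboolP/exposed_face[_ vI]] /andP[_ /asboolP/exposed_face[_ vJ]] h.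
  by rewrite -vI -vJ -!/(psi _) h.
rewrite /nfaces; have -> : [set F | face point_hull F /\ affine_dim F k.-1] =
    [set` [fset F in map psi (enum E)]%fset].
  apply/seteqP; split=> F /=.
    move=> [faceF dimF]; rewrite !inE; apply/mapP; exists (vertices F); last exact: face_vertices.
    rewrite mem_enum inE; apply/andP; split; last by apply/asboolP/face_exposed.
    have FE := face_vertices faceF; move: dimF; rewrite {1}FE => dimF.
    have [p0 p0I] : exists p, p \in vertices F.
      have [x0 [[_ [a [_ aI a1 _]]] _]] := dimF.
      apply/existsP; apply: contraPT a1 => /existsPn hn.
      by rewrite big1 => [/esym/eqP|p _]; rewrite ?oner_eq0 // aI.
    move: dimF => /(affine_dim_face _ p0I).
    have cI : (0 < #|vertices F|)%N by apply/card_gt0P; exists p0.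
    case: (leqP #|vertices F| d.+1) => hI.
      rewrite dim_edge_space // => h; apply/eqP; lia.
    by rewrite edge_space_full ?(ltnW hI) // dimvf /dim /= mul1n; lia.
  rewrite !inE => /mapP[I]; rewrite mem_enum inE => /andP[/eqP Ik /asboolP eI] ->.
  have [faceI vI] := exposed_face eI; split=> //.
  have /card_gt0P[p0 p0I] : (0 < #|I|)%N by rewrite Ik.
  by apply/(affine_dim_face _ p0I); rewrite dim_edge_space ?Ik //; lia.
rewrite set_fsetK card_fseq undup_id ?size_map -?cardE //.
rewrite map_inj_in_uniq ?enum_uniq // => I J; rewrite !mem_enum; exact: psi_inj.
Qed.

End FacesOfHull.

(** * Null sets and measurable events *)

Section NullSets.
Import HBNNSimple.
Local Open Scope classical_set_scope.
Local Open Scope ring_scope.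
Context {disp : measure_display} {T : measurableType disp} {R : realType}.
Variable mu : {measure set T -> \bar R}.
Local Open Scope ereal_scope.

(** The integral of a nonnegative function is the supremum over the simple
    functions below it, so it may be changed on a null set even when the
    function is not known to be measurable. *)
Lemma ge0_integral_off_null (f g : T -> \bar R) (M : set T) :
  measurable M -> mu M = 0 -> measurable_fun setT g ->
  (forall w, 0 <= f w) -> (forall w, 0 <= g w) ->
  (forall w, ~ M w -> f w = g w) ->
  \int[mu]_w f w = \int[mu]_w g w.
Proof.
move=> mM M0 mg f0 g0 fg; have mD : measurable (setT `\` M) by exact: measurableD.
apply/eqP; rewrite eq_le; apply/andP; split.
  rewrite ge0_integralTE //; apply: ge_ereal_sup => _ [h /= hf <-].
  have -> : sintegral mu h = \int[mu]_w (h w)%:E.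
    by rewrite (integral_nnsfun mu measurableT) patch_setT.
  have h0 w : 0 <= (h w)%:E by rewrite lee_fin.
  have mh : measurable_fun setT (fun w => (h w)%:E) by exact/measurable_EFinP.
  rewrite (ge0_negligible_integral mM measurableT mh (fun w _ => h0 w) M0).
  rewrite (ge0_negligible_integral mM measurableT mg (fun w _ => g0 w) M0).
  apply: ge0_le_integral => //.
  - exact: measurable_funTS.
  - exact: measurable_funTS.
  - by move=> w [_ /fg <-].
rewrite (ge0_negligible_integral mM measurableT mg (fun w _ => g0 w) M0).
rewrite integral_mkcond !ge0_integralTE //; last first.
  by move=> w; rewrite /patch; case: ifP.
apply: le_ereal_sup => _ [h /= hg <-]; exists h => //= w.
apply: le_trans (hg w) _; rewrite /patch; case: ifPn => //.
by rewrite inE => -[_ /fg ->].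
Qed.

End NullSets.

Section RandomCounts.
Local Open Scope classical_set_scope.
Local Open Scope ring_scope.
Context {disp : measure_display} {T : measurableType disp} {R : realType}.
Variable P : probability T R.
Variables (J : finType) (A : J -> set T).
Hypothesis mA : forall j, measurable (A j).

Definition random_count (w : T) : R := \sum_j `[< A j w >]%:R.

Lemma asbool_indic j w : `[< A j w >]%:R = \1_(A j) w :> R.
Proof. by rewrite indicE; case: asboolP => h; [rewrite mem_set|rewrite memNset]. Qed.

Lemma measurable_random_count : measurable_fun setT random_count.
Proof.
apply: measurable_sum => j.
rewrite (_ : (fun w => _) = \1_(A j)); first exact: measurable_indic.
by apply/funext => w; rewrite asbool_indic.
Qed.

Lemma integral_random_count :
  (\int[P]_w (random_count w)%:E = (\sum_j fine (P (A j)))%:E)%E.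
Proof.
rewrite -sumEFin.
under eq_integral => w _ do rewrite /random_count -sumEFin.
rewrite ge0_integral_sum //.
- apply: eq_bigr => j _; rewrite fineK ?fin_num_measure //.
  have := integral_indic P measurableT (mA j); rewrite setIT => <-.
  by apply: eq_integral => w _; rewrite asbool_indic.
- move=> j; apply/measurable_EFinP.
  rewrite (_ : (fun w => _) = \1_(A j)); first exact: measurable_indic.
  by apply/funext => w; rewrite asbool_indic.
Qed.

Lemma random_count_ge0 w : 0 <= random_count w.
Proof. exact: sumr_ge0. Qed.

Variable M : set T.
Hypotheses (mM : measurable M) (M0 : P M = 0%E).

Lemma prob_offM : P (setT `\` M) = 1%E.
Proof. by rewrite setTD probability_setC // M0 sube0. Qed.

Lemma sum_prob_le (K : R) : (forall w, ~ M w -> random_count w <= K) ->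
  \sum_j fine (P (A j)) <= K.
Proof.
move=> hK; have mD : measurable (setT `\` M) by exact: measurableD.
have mc : measurable_fun setT (EFin \o random_count).
  exact/measurable_EFinP/measurable_random_count.
rewrite -lee_fin -integral_random_count (ge0_negligible_integral mM) //; last first.
  by move=> w _; rewrite lee_fin random_count_ge0.
have [w [_ wM]] : (setT `\` M) !=set0.
  apply/set0P/eqP => h; have := prob_offM; rewrite h measure0 => -[] /esym/eqP.
  by rewrite oner_eq0.
have K0 : 0 <= K by apply: le_trans (hK w wM); apply: random_count_ge0.
apply: (@le_trans _ _ (\int[P]_(w in setT `\` M) (cst K%:E) w)%E).
  apply: ge0_le_integral => //.
  - by move=> v _; rewrite lee_fin random_count_ge0.
  - exact: measurable_funTS.
  - by move=> v [_ /hK]; rewrite lee_fin.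
by rewrite integral_cst // [X in (_ * X)%E](_ : _ = 1%E) ?mule1 //; exact: prob_offM.
Qed.

Lemma sum_prob_ge (K : R) : 0 <= K -> (forall w, ~ M w -> K <= random_count w) ->
  K <= \sum_j fine (P (A j)).
Proof.
move=> K0 hK; have mD : measurable (setT `\` M) by exact: measurableD.
have mc : measurable_fun setT (EFin \o random_count).
  exact/measurable_EFinP/measurable_random_count.
rewrite -lee_fin -integral_random_count (ge0_negligible_integral mM) //; last first.
  by move=> w _; rewrite lee_fin random_count_ge0.
apply: (@le_trans _ _ (\int[P]_(w in setT `\` M) (cst K%:E) w)%E).
  by rewrite integral_cst // [X in (_ * X)%E](_ : _ = 1%E) ?mule1 //; exact: prob_offM.
apply: ge0_le_integral => //.
- exact: measurable_funTS.
- by move=> v [_ /hK]; rewrite lee_fin.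
Qed.

End RandomCounts.

Section TupleEvents.
Local Open Scope classical_set_scope.
Local Open Scope ring_scope.
Variables (R : realType) (N d : nat).
Local Notation TT := (N.-tuple (borel_rV R d)).

Definition tuple_steps (t : TT) (j : 'I_N) : 'rV[R]_d := tnth t j.

Lemma measurable_coord (l : 'I_d) :
  measurable_fun [set: borel_rV R d] (fun v : borel_rV R d => (v : 'rV[R]_d) 0 l).
Proof.
apply: (measurability _ (RGenOInfty.measurableE R)) => _ [_ [x ->] <-].
rewrite setTI; apply: sub_sigma_algebra => /=.
have -> : (fun v : borel_rV R d => (v : 'rV[R]_d) 0 l) @^-1` `]x, +oo[ =
    (fun v : 'rV[R]_d => v 0 l) @^-1` [set y | x < y].
  by apply/seteqP; split => v /=; rewrite in_itv /= andbT.
apply: open_comp; last exact: open_gt.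
by move=> v _; apply: coord_continuous.
Qed.

Lemma measurable_step j l :
  measurable_fun [set: TT] (fun t : TT => tuple_steps t j 0 l).
Proof.
exact: (measurableT_comp (measurable_coord l) (measurable_tnth j)).
Qed.

Lemma measurable_partial_sum (s : {perm 'I_N}) i l :
  measurable_fun [set: TT] (fun t : TT => partial_sum (tuple_steps t \o s) i 0 l).
Proof.
rewrite (_ : (fun t : TT => _) = (fun t => \sum_(j < N)
    (if (j < i)%N then tuple_steps t (s j) 0 l else 0))).
  apply: measurable_sum => j; case: (j < i)%N; last exact: measurable_cst.
  exact: measurable_step.
by apply/funext => t; rewrite /partial_sum summxE big_mkcond.
Qed.

Lemma measurable_increment (s : {perm 'I_N}) p l :
  measurable_fun [set: TT] (fun t : TT => walk_increments (tuple_steps t \o s) p l).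
Proof.
rewrite (_ : (fun t : TT => _) = (fun t => partial_sum (tuple_steps t \o s) p 0 l -
   partial_sum (tuple_steps t \o s) (ord_pred p) 0 l)).
  by apply: measurable_funB; apply: measurable_partial_sum.
by apply/funext => t; rewrite !mxE.
Qed.

Definition descent_event (s : {perm 'I_N}) (I : {set 'I_N.+1}) : set TT :=
  [set t | integral_descent (walk_increments (tuple_steps t \o s)) I].

Lemma measurable_descent_event s I : measurable (descent_event s I).
Proof.
pose C (B m : nat) (z : {ffun 'I_N.+1 -> int}) : set TT :=
  [set t | (forall p, p \notin I -> m%:Z <= z p - z (ordS p)) /\
    forall l, `|\sum_p (z p)%:~R * walk_increments (tuple_steps t \o s) p l| <= B%:R].
have -> : descent_event s I = \bigcup_B \bigcap_m \bigcup_z C B m z.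
  apply/seteqP; split => t /=.
    by move=> [B hB]; exists B => // m _; have [z hz] := hB m; exists z.
  by move=> [B _ hB]; exists B => m; have [z _ hz] := hB m Logic.I; exists z.
apply: bigcupT_measurable => B; apply: bigcapT_measurable => m.
apply: countable_bigcupT_measurable; first exact: countableP.
move=> z; rewrite /C.
have [hz|hz] := pselect (forall p, p \notin I -> m%:Z <= z p - z (ordS p)); last first.
  rewrite (_ : [set _ | _] = set0); first exact: measurable0.
  by apply/seteqP; split => t //= -[].
rewrite (_ : [set _ | _] = \bigcap_(l in [set: 'I_d])
  [set t : TT | `|\sum_p (z p)%:~R * walk_increments (tuple_steps t \o s) p l| <= B%:R]).
  apply: fin_bigcap_measurable; first exact: finite_finset.
  move=> l _; rewrite -[X in measurable X]setTI.
  apply: measurable_fun_le => //.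
  apply: measurableT_comp; first exact: normr_measurable.
  apply: measurable_sum => p; apply: measurable_funM; first exact: measurable_cst.
  exact: measurable_increment.
by apply/seteqP; split => t /= => [[_ h] l _|h]; [exact: h|split=> // l; exact: h].
Qed.

Lemma free_det (u : 'I_d -> 'rV[R]_d) :
  free [tuple u a | a < d] = (\det (\matrix_(a < d) u a) != 0).
Proof.
rewrite -unitfE -unitmxE; apply/idP/idP => [fu|uM].
  rewrite -row_full_unit; apply: row_full_inj => c hc; apply: (free_orthogonal fu) => a.
  have := congr1 (fun v : 'cV[R]_d => v a 0) hc; rewrite /= [RHS]mxE => <-.
  by rewrite -{1}[u a](rowK u) -row_mul [LHS]mxE.
apply/freeP => y hy a.
have : (\row_i y i) *m (\matrix_(a < d) u a) = 0.
  rewrite mulmx_sum_row -[RHS]hy; apply: eq_bigr => i _.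
  by rewrite mxE rowK -tnth_nth tnth_mktuple.
move/(congr1 (mulmxr (invmx (\matrix_(a < d) u a)))); rewrite /= mulmxK // mul0mx.
by move/rowP => /(_ a); rewrite !mxE.
Qed.

Definition degenerate_event (t : 'I_d -> nat) : set TT :=
  [set x | ~~ free [tuple partial_sum (tuple_steps x) (t a) | a < d]].

Lemma measurable_degenerate_event t : measurable (degenerate_event t).
Proof.
rewrite (_ : degenerate_event t = (fun x : TT => \det (\matrix_(a < d)
    partial_sum (tuple_steps x) (t a))) @^-1` [set 0]); last first.
  by apply/seteqP; split => x /=; rewrite /degenerate_event /= free_det negbK => /eqP.
rewrite -[X in measurable X]setTI.
suff mf : measurable_fun [set: TT] (fun x : TT => \det (\matrix_(a < d)
    partial_sum (tuple_steps x) (t a))) by apply: mf => //; exact: measurable_set1.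
rewrite (_ : (fun x : TT => _) = fun x => \sum_(s : {perm 'I_d}) (-1) ^+ s *
   \prod_a partial_sum (tuple_steps x) (t a) 0 (s a)); last first.
  by apply/funext => x; apply: eq_bigr => s _; congr (_ * _); apply: eq_bigr => a _; rewrite mxE.
apply: measurable_sum => s; apply: measurable_funM; first exact: measurable_cst.
apply: measurable_prod => a _.
rewrite (_ : (fun x : TT => _) = fun x : TT => partial_sum (tuple_steps x \o (1%g : {perm 'I_N})) (t a) 0 (s a)).
  exact: measurable_partial_sum.
apply/funext => x; congr (partial_sum _ _ _ _).
by apply/funext => j; rewrite /= perm1.
Qed.

End TupleEvents.

(** * The expected number of faces *)

Section ExpectedFaces.
Local Open Scope classical_set_scope.
Local Open Scope ring_scope.
Context {R : realType} {disp : measure_display} {T : measurableType disp}.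
Variables (P : probability T R) (d m : nat) (xi : 'I_m -> {RV P >-> borel_rV R d}).
Local Notation n := m.+1.

Let steps (w : T) (j : 'I_m) : 'rV[R]_d := xi j w.
Let tup (s : {perm 'I_m}) (w : T) : m.-tuple (borel_rV R d) := [tuple xi (s i) w | i < m].

Let tuple_stepsE s w : tuple_steps (tup s w) = steps w \o s.
Proof. by apply/funext => j; rewrite /tuple_steps tnth_mktuple. Qed.

Let comp_perm1 (x : 'I_m -> 'rV[R]_d) : x \o (1%g : {perm 'I_m}) = x.
Proof. by apply/funext => j /=; rewrite perm1. Qed.

Let measurable_tup s : measurable_fun [set: T] (tup s).
Proof.
apply/measurable_fun_tnthP => i; rewrite (_ : _ \o _ = xi (s i)) //.
by apply/funext => w; rewrite /= tnth_mktuple.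
Qed.

Let measurable_tup_preimage s A : measurable A -> measurable (tup s @^-1` A).
Proof. by move=> mA; rewrite -[X in measurable X]setTI; apply: measurable_tup. Qed.

Hypothesis xi_exch : exchangeable xi.
Hypothesis xi_gp : general_position xi.

Let law_tup s A : measurable A -> P (tup s @^-1` A) = P (tup 1%g @^-1` A).
Proof.
move=> mA; have h r : P (tup r @^-1` A) = pushforward P (fun w => [tuple xi i w | i < m]) A.
  exact: xi_exch mA.
by rewrite !h.
Qed.

Definition valid_times (t : {ffun 'I_d -> 'I_n}) : Prop :=
  (forall a, (0 < t a)%N) /\ {homo t : a b / (a < b)%N}.

Definition degenerate_at (q : {perm 'I_m} * {ffun 'I_d -> 'I_n}) : set T :=
  if `[< valid_times q.2 >] then tup q.1 @^-1` degenerate_event (fun a => q.2 a)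
  else set0.

(** Some reordering of the walk violates general position. The finite union over
    orders and times is indexed by [nat] through the countable encoding of these
    pairs. *)
Definition degenerate : set T :=
  \bigcup_i oapp degenerate_at set0 (@choice.unpickle ({perm 'I_m} * {ffun 'I_d -> 'I_n})%type i).

Let measurable_degenerate_at q : measurable (degenerate_at q).
Proof.
rewrite /degenerate_at; case: asboolP => _; last exact: measurable0.
apply: measurable_tup_preimage; exact: measurable_degenerate_event.
Qed.

Lemma measurable_degenerate : measurable degenerate.
Proof.
apply: bigcupT_measurable => i; case: choice.unpickle => [q|] /=; last exact: measurable0.
exact: measurable_degenerate_at.
Qed.

Lemma degenerate_null : P degenerate = 0%E.
Proof.
apply: measure_negligible; first exact: measurable_degenerate.
apply: negligible_bigcup => i; case: choice.unpickle => [q|] /=; last exact: negligible_set0.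
apply/negligibleP; first exact: measurable_degenerate_at.
rewrite /degenerate_at; case: asboolP => [[t0 ht]|_]; last by rewrite measure0.
have mE := measurable_degenerate_event (N := m) (fun a => q.2 a).
have tN a : (0 < q.2 a <= m)%N by rewrite t0 -ltnS ltn_ord.
transitivity (P (tup 1%g @^-1` degenerate_event (fun a => q.2 a))); first exact: law_tup.
rewrite -[RHS](xi_gp tN ht); congr (P _).
apply/seteqP; split => w /=; rewrite /degenerate_event /= tuple_stepsE.
  by rewrite comp_perm1.
by rewrite comp_perm1.
Qed.

Hypothesis dm : (d <= m)%N.

Lemma generic_off_degenerate w : ~ degenerate w -> generic_classes (walk_increments (steps w)).
Proof.
move=> nw; apply: generic_walk => // s t tm ht; apply: contraT => nfree; case: nw.
pose t' : {ffun 'I_d -> 'I_n} := [ffun a => inord (t a)].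
have t'E a : t' a = t a :> nat by rewrite ffunE inordK // ltnS; case/andP: (tm a).
exists (choice.pickle (s, t')) => //=; rewrite choice.pickleK /= /degenerate_at /=.
rewrite asboolT; last by split=> [a|a b ab]; rewrite !t'E ?ht //; case/andP: (tm a).
rewrite /= /degenerate_event /= tuple_stepsE.
rewrite (@eq_map _ _ _ (fun a => partial_sum (steps w \o s) (t a))) => [|a]; last by rewrite t'E.
exact: nfree.
Qed.

Let walk_hullE w : walk_hull xi w = point_hull (walk_points (steps w)).
Proof.
rewrite /walk_hull /point_hull; congr (smallest _ _); apply/seteqP; split => x /=.
  move=> [i ilt <-]; exists (inord i) => //; apply/rowP => l.
  by rewrite !mxE inordK.
by move=> [p _ <-]; exists p; [exact: ltn_ord|apply/rowP => l; rewrite !mxE].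
Qed.

Let descent_at s I : set T := tup 1%g @^-1` descent_event s I.

Let descent_atE s I w :
  descent_at s I w <-> integral_descent (walk_increments (steps w \o s)) I.
Proof.
rewrite /descent_at /= /descent_event /= tuple_stepsE.
by rewrite comp_perm1.
Qed.

Let measurable_descent_at s I : measurable (descent_at s I).
Proof. by apply: measurable_tup_preimage; exact: measurable_descent_event. Qed.

Let prob_descent_at s I : P (descent_at s I) = P (descent_at 1%g I).
Proof.
have mE := @measurable_descent_event R m d 1%g I.
rewrite -[RHS](law_tup s mE); congr (P _); apply/seteqP; split => w.
  move=> /descent_atE; rewrite /= /descent_event /= tuple_stepsE.
  by rewrite comp_perm1.
rewrite /= {1}/descent_event /= tuple_stepsE => h; apply/descent_atE; move: h.
by rewrite comp_perm1.
Qed.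

(** By exchangeability the probability that a set of indices fails to span a
    face may be averaged over all orders of the increments; the expected
    number of faces is thereby controlled by a deterministic count. *)
Lemma expected_faces k : (0 < k <= d)%N -> exists e : R,
  [/\ ('E_P[fun w => (nfaces k.-1 (walk_hull xi w))%:R] = e%:E)%E,
    0 <= e <= ('C(n, k))%:R,
    forall K : R, (forall x : 'I_m -> 'rV[R]_d, generic_classes (walk_increments x) ->
       (descent_count k x)%:R <= K) -> m`!%:R * (('C(n, k))%:R - e) <= K
  & forall K : R, 0 <= K -> (forall x : 'I_m -> 'rV[R]_d, generic_classes (walk_increments x) ->
       K <= (descent_count k x)%:R) -> K <= m`!%:R * (('C(n, k))%:R - e)].
Proof.
move=> /andP[k0 kd].
pose A (I : {set 'I_n}) : set T := if #|I| == k then ~` descent_at 1%g I else set0.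
have mA I : measurable (A I).
  by rewrite /A; case: ifP => _; [apply: measurableC; apply: measurable_descent_at|exact: measurable0].
have A_le1 I : 0 <= fine (P (A I)) <= 1.
  rewrite fine_ge0 //=; have := probability_le1 P (mA I).
  by rewrite -[X in (X <= _)%E]fineK ?fin_num_measure // lee_fin.
pose e := \sum_I fine (P (A I)).
have eE : ('E_P[fun w => (nfaces k.-1 (walk_hull xi w))%:R] = e%:E)%E.
  rewrite unlock /e -integral_random_count //.
  apply: (ge0_integral_off_null measurable_degenerate degenerate_null).
  - exact/measurable_EFinP/measurable_random_count.
  - by move=> w; rewrite lee_fin.
  - by move=> w; rewrite lee_fin random_count_ge0.
  move=> w /generic_off_degenerate gw; congr (_%:E).
  rewrite walk_hullE nfaces_exposed ?k0 //.
  rewrite -sum1dep_card natr_sum big_mkcond; apply: eq_bigr => I _.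
  rewrite /A; case: eqP => /= Ik; last by case: asboolP.
  have I_bounds : (0 < #|I| < n)%N by rewrite Ik k0 ltnS (leq_trans kd).
  have -> : `[< (~` descent_at 1%g I) w >] = `[< exposed (walk_points (steps w)) I >].
    apply: asbool_equiv_eq; rewrite exposed_iff //.
    by rewrite /= descent_atE comp_perm1.
  by case: asbool.
pose B (s : {perm 'I_m}) (I : {set 'I_n}) : set T := if #|I| == k then descent_at s I else set0.
have eP : m`!%:R * (('C(n, k))%:R - e) =
    \sum_(q : {perm 'I_m} * {set 'I_n}) fine (P (B q.1 q.2)).
  rewrite -(pair_bigA _ (fun s I => fine (P (B s I)))) /=.
  rewrite (eq_bigr (fun=> ('C(n, k))%:R - e)) => [|s _].
    by rewrite sumr_const card_Sn mulr_natl.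
  rewrite /e -[in 'C(_, _)](card_ord n) -card_draws -sum1dep_card natr_sum [X in _ = X - _]big_mkcond -sumrB.
  apply: eq_bigr => I _; rewrite /A /B; case: ifP => _; last by rewrite measure0 subrr.
  rewrite prob_descent_at probability_setC; last exact: measurable_descent_at.
  by rewrite fineB ?fin_num_measure //=; ring.
have mB (q : {perm 'I_m} * {set 'I_n}) :
    measurable (B q.1 q.2).
  by rewrite /B; case: ifP => _; [exact: measurable_descent_at|exact: measurable0].
have cnt w : ~ degenerate w ->
    random_count (R := R) (fun q : {perm 'I_m} * {set 'I_n} => B q.1 q.2) w = (descent_count k (steps w))%:R.
  move=> /generic_off_degenerate gw; rewrite /random_count /descent_count natr_sum.
  rewrite -(pair_bigA _ (fun s I => `[< B s I w >]%:R)) /=.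
  apply: eq_bigr => s _; rewrite natr_sum [RHS]big_mkcond; apply: eq_bigr => I _.
  rewrite /B; case: eqP => Ik; last by case: asboolP.
  have I_bounds : (0 < #|I| < n)%N by rewrite Ik k0 ltnS (leq_trans kd).
  have gs : generic_classes (walk_increments (steps w \o s)).
    by rewrite walk_increments_perm; apply: generic_row_perm.
  congr ((nat_of_bool _)%:R); apply: asbool_equiv_eq.
  by rewrite descent_atE; apply: descent_iff.
exists e; split=> //.
- apply/andP; split; first by apply: sumr_ge0 => I _; case/andP: (A_le1 I).
  rewrite -[in 'C(_, _)](card_ord n) -card_draws -sum1dep_card natr_sum [leRHS]big_mkcond.
  apply: ler_sum => I _; case: ifP => Ik; first by case/andP: (A_le1 I).
  by rewrite /A Ik measure0.
- move=> K hK; rewrite eP; apply: (sum_prob_le mB measurable_degenerate degenerate_null).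
  by move=> w nw; rewrite cnt //; apply: hK; apply: generic_off_degenerate.
- move=> K K0 hK; rewrite eP; apply: (sum_prob_ge mB measurable_degenerate degenerate_null) => //.
  by move=> w nw; rewrite cnt //; apply: hK; apply: generic_off_degenerate.
Qed.

End ExpectedFaces.

Section FaceRatio.
Local Open Scope classical_set_scope.
Local Open Scope ring_scope.
Context {R : realType} {disp : measure_display} {T : measurableType disp}.
Variables (P : probability T R) (d m k : nat) (xi : 'I_m -> {RV P >-> borel_rV R d}).
Local Notation n := m.+1.
Hypotheses (xi_exch : exchangeable xi) (xi_gp : general_position xi).
Hypotheses (dm : (d <= m)%N) (kd : (0 < k <= d)%N).

Let q : R := ln (n%:R / k%:R).

Let k_gt0 : (0 : R) < k%:R. Proof. by rewrite ltr0n; case/andP: kd. Qed.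
Let n_gt0 : (0 : R) < n%:R. Proof. by []. Qed.
Let kn : (0 < k <= n)%N. Proof. by case/andP: kd => -> /= h; rewrite leqW // (leq_trans h). Qed.
Let bin_gt0R : (0 : R) < 'C(n, k)%:R. Proof. by rewrite ltr0n bin_gt0; case/andP: kn. Qed.

Lemma expR_power (t : R) j : 0 < t -> t ^+ j = expR (j%:R * ln t).
Proof. by move=> t0; rewrite expRM_natl lnK. Qed.

(** With [q = ln (n / k)] there are about [exp (k q)] sets of [k] vertices, whereas
    the total weight of the marked sets is about [exp (t k q)]; the loss
    [t ^ -(d + 1)] is smaller than the gain [exp ((1 - t) k q)] when [k q] exceeds
    [d] by a constant factor and [t] is close to 1. The factor [exp (4 k)] absorbs
    all other constants. *)
Lemma upper_weight_le (t : R) : 0 < t <= 1 -> (2 * k <= n)%N ->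
  n%:R / k%:R * (\sum_(I : {set 'I_n} | marked k I) block_product k t I) / t ^+ d.+1 <=
  'C(n, k)%:R * expR (q * (1 - (1 - t) * k%:R) + 4 * k%:R + d.+1%:R * (t^-1 - 1)).
Proof.
move=> t01 k2n; have /andP[t0 t1] := t01.
have := sum_block_product_le kn t01; rewrite -/q.
set W := \sum_(I | _) _ => hW.
have nkE : n%:R / k%:R = expR q by rewrite /q lnK // posrE divr_gt0.
have x2 : k%:R / n%:R <= 2^-1 :> R.
  by rewrite ler_pdivrMr // mulrC ler_pdivlMr // mulrC -natrM ler_nat.
pose r : R := 1 - k%:R / n%:R.
have r0 : 0 < r by rewrite /r; move: x2; set x := k%:R / n%:R; lra.
have lnr : - (2 * k%:R) <= n%:R * ln r.
  have := @ln_le_sub1 R r^-1; rewrite invr_gt0 => /(_ r0); rewrite lnV ?posrE // => h.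
  have h2 : r^-1 - 1 <= 2 * (k%:R / n%:R).
    rewrite -(ler_pM2r r0) mulrBl mulVf ?gt_eqF // mul1r /r.
    move: x2; have : (0 : R) <= k%:R / n%:R by rewrite divr_ge0.
    by set x := k%:R / n%:R => x0 x2; nra.
  have : - ln r <= 2 * (k%:R / n%:R) by apply: le_trans h2.
  rewrite -(ler_pM2l n_gt0) mulrN mulrCA [n%:R * (_ / _)]mulrC divfK ?gt_eqF //.
  by rewrite lerNl.
have bin : expR (k%:R * q) <= 'C(n, k)%:R.
  have := bin_ge (proj2 (andP kn)); rewrite -(ler_nat R) natrM !natrX => h.
  by rewrite expRM_natl -nkE expr_div_n ler_pdivrMr ?exprn_gt0.
have two : (2 : R) ^+ k <= expR k%:R.
  rewrite -[k%:R]mulr1 expRM_natl lerXn2r ?nnegrE ?expR_ge0 //.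
  by have := expR_ge1Dx (1 : R); lra.
have W_le : W <= expR (k%:R + k%:R * (t * (1 + q)) + 2 * k%:R).
  rewrite expRD -ler_pdivrMr ?expR_gt0 // -expRN.
  apply: (@le_trans _ _ (W * r ^+ n)).
    rewrite ler_wpM2l //; last by rewrite expR_power // ler_expR.
    apply: sumr_ge0 => I _; apply: prodr_ge0 => b _; rewrite ltW // rising_ratio_gt0 //.
  apply: le_trans hW _; rewrite exprMn expRD ler_pM ?exprn_ge0 ?expR_ge0 //.
  by rewrite -expRM_natl.
have t_le : (t ^+ d.+1)^-1 <= expR (d.+1%:R * (t^-1 - 1)).
  rewrite expR_power // -expRN ler_expR -mulrN ler_wpM2l // -lnV ?posrE //.
  by apply: ln_le_sub1; rewrite invr_gt0.
have W0 : 0 <= W.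
  by apply: sumr_ge0 => I _; apply: prodr_ge0 => b _; rewrite ltW // rising_ratio_gt0.
rewrite nkE; apply: (@le_trans _ _ (expR q * expR (k%:R + k%:R * (t * (1 + q)) + 2 * k%:R)
   * expR (d.+1%:R * (t^-1 - 1)))).
  by rewrite ler_pM ?mulr_ge0 ?expR_ge0 ?invr_ge0 ?exprn_ge0 ?(ltW t0) // ler_pM2l ?expR_gt0.
apply: (@le_trans _ _ (expR (k%:R * q) *
    expR (q * (1 - (1 - t) * k%:R) + 4 * k%:R + d.+1%:R * (t^-1 - 1)))); last first.
  by rewrite ler_wpM2r // expR_ge0.
rewrite -!expRD ler_expR.
have tk : t * k%:R <= k%:R by rewrite ler_piMl // ltW.
by nra.
Qed.

(** The two tilted counts, [t = 1 + delta] against missing faces and [t < 1]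
    against faces. *)
Lemma face_ratio_bounds : exists e : R,
  [/\ ('E_P[fun w => (nfaces k.-1 (walk_hull xi w))%:R] = e%:E)%E,
    0 <= e / 'C(n, k)%:R <= 1,
    forall delta : R, 0 <= delta ->
      1 - e / 'C(n, k)%:R <= expR (delta * (k%:R + k%:R * q) - d%:R * ln (1 + delta))
  & forall t : R, 0 < t <= 1 -> (2 * k <= n)%N ->
      e / 'C(n, k)%:R <=
      expR (q * (1 - (1 - t) * k%:R) + 4 * k%:R + d.+1%:R * (t^-1 - 1))].
Proof.
have [e [eE /andP[e0 eC] upper lower]] := expected_faces xi_exch xi_gp dm kd.
have m0 : (0 : R) < m`!%:R by rewrite ltr0n fact_gt0.
exists e; split=> //.
- by rewrite divr_ge0 //= ler_pdivrMr // mul1r.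
- move=> delta delta0; set t := 1 + delta.
  have t1 : 1 <= t by rewrite lerDl.
  have t0 : 0 < t by apply: lt_le_trans t1.
  set B := expR (delta * (k%:R + k%:R * q)).
  have tE : t - 1 = delta by rewrite /t addrAC subrr add0r.
  have hB (I : {set 'I_n}) : marked k I -> block_product k t I <= B.
    by move=> mI; have := block_product_le mI kn t1; rewrite tE.
  have := upper ((m`! * 'C(n, k))%:R * (B / t ^+ d)).
  have h (x : 'I_m -> 'rV[R]_d) : generic_classes (walk_increments x) ->
      (descent_count k x)%:R <= (m`! * 'C(n, k))%:R * (B / t ^+ d) :> R.
    move=> gx; rewrite mulrA ler_pdivlMr ?exprn_gt0 //.
    exact: descent_count_le gx dm (proj1 (andP kd)) t1 hB.
  move=> /(_ h); rewrite natrM -mulrA ler_pM2l // => h'.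
  rewrite expRD -/B expRN -expR_power //.
  rewrite -(ler_pM2l bin_gt0R); apply: le_trans h'.
  by rewrite mulrBr mulr1 mulrC divfK // gt_eqF.
- move=> t t01 k2n; have := upper_weight_le t01 k2n.
  set W := \sum_(I | _) _; set E := expR _ => hE; have /andP[t0 _] := t01.
  rewrite ler_pdivrMr // mulrC; apply: le_trans hE.
  pose L := n%:R / k%:R * W / t ^+ d.+1.
  rewrite -/L; have td : 0 < t ^+ d.+1 by rewrite exprn_gt0.
  have hK (x : 'I_m -> 'rV[R]_d) : generic_classes (walk_increments x) ->
      m`!%:R * ('C(n, k)%:R - L) <= (descent_count k x)%:R :> R.
    move=> gx; have := descent_count_ge k gx dm t01; rewrite -/W factS !natrM => h.
    have e2 : n%:R * m`!%:R * W = k%:R * t ^+ d.+1 * (m`!%:R * L).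
      by rewrite /L; field; rewrite !gt_eqF.
    by move: h; rewrite mulrAC e2 ler_pM2l ?mulr_gt0 // mulrBr lerBlDr [leRHS]addrC -lerBlDr.
  have [K0|K0] := leP 0 (m`!%:R * ('C(n, k)%:R - L)).
    have := lower _ K0 hK; rewrite ler_pM2l //; lra.
  by move: K0; rewrite pmulr_rlt0 // subr_lt0 => /ltW; apply: le_trans.
Qed.

End FaceRatio.

Local Open Scope classical_set_scope.
Local Open Scope ring_scope.

(** * The two regimes *)

Section Exponents.
Variable R : realType.
Implicit Types d k q eps : R.

Lemma ln1p_ge (x : R) : 0 <= x -> x - x ^+ 2 <= ln (1 + x).
Proof.
move=> x0; have h : 0 < 1 + x by rewrite ltr_pwDl.
have := @ln_le_sub1 R (1 + x)^-1; rewrite invr_gt0 => /(_ h); rewrite lnV ?posrE // => hl.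
have : (1 + x)^-1 - 1 <= x ^+ 2 - x.
  rewrite -(ler_pM2r h) mulrBl mulVf ?gt_eqF // mul1r.
  have : 0 <= x ^+ 3 by rewrite exprn_ge0.
  by rewrite !exprS expr0; nra.
move: hl; set a := _^-1; set b := ln _; lra.
Qed.

(** In the regime [k q <= (1 - eps) d], tilting by [1 + eps / 2] makes the gain
    [d ln (1 + eps / 2)] exceed the cost [eps / 2 * k q] by a multiple of [d]. *)
Lemma exponent_few d k q eps : 0 < eps -> 0 <= d -> k * q <= (1 - eps) * d ->
  k <= eps / 4 * d ->
  eps / 2 * (k + k * q) - d * ln (1 + eps / 2) <= - (eps ^+ 2 / 8 * d).
Proof.
move=> e0 d0 kq ke; have x0 : 0 <= eps / 2 by rewrite divr_ge0 // ltW.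
have := ln1p_ge x0; set L := ln _ => hL.
have : d * (eps / 2 - (eps / 2) ^+ 2) <= d * L by rewrite ler_wpM2l.
have : eps * (k * q) <= eps * ((1 - eps) * d) by rewrite ler_pM2l.
have : eps * k <= eps * (eps / 4 * d) by rewrite ler_pM2l.
by rewrite !expr2; lra.
Qed.

(** In the regime [k q >= (1 + eps) d], this [delta] makes
    [1 / (1 - delta) - 1] equal to [eps / (2 + eps)], so that the cost is at most
    [(delta - theta) k q] and a gain of [theta k q] remains. *)
Lemma exponent_many d k q eps (delta := eps / (2 * (1 + eps)))
    (theta := delta * (eps / (2 + eps))) :
  0 < eps -> 1 <= k -> 0 <= q -> (1 + eps) * d <= k * q -> 2 <= theta * k -> 12 <= theta * q ->
  q * (1 - delta * k) + 4 * k + (d + 1) * ((1 - delta)^-1 - 1) <= - k.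
Proof.
move=> e0 k1 q0 dq tk tq.
have e1 : 0 < 1 + eps by rewrite ltr_pwDl // ltW.
have e2 : 0 < 2 + eps by rewrite ltr_pwDl // ltW.
have tE : (1 - delta)^-1 - 1 = eps / (2 + eps).
  have -> : 1 - delta = (2 + eps) / (2 * (1 + eps)).
    by rewrite /delta; field; rewrite gt_eqF.
  by rewrite invf_div; field; rewrite gt_eqF.
set beta := eps / (2 + eps) in theta tE tk tq *.
have b0 : 0 <= beta by rewrite divr_ge0 // ltW.
have b1 : beta <= 1 by rewrite ler_pdivrMr // mul1r lerDr.
have dE : beta * (d * (1 + eps)) = (delta - theta) * (1 + eps) * (d * (1 + eps)).
  by rewrite /theta /delta /beta; field; rewrite !gt_eqF.
have thd : 0 <= (delta - theta).
  rewrite /theta -[X in X - _]mulr1 -mulrBr mulr_ge0 ?subr_ge0 //.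
  by rewrite divr_ge0 ?mulr_ge0 // ltW.
have bd : beta * d <= (delta - theta) * (k * q).
  have -> : beta * d = (delta - theta) * ((1 + eps) * d).
    by apply: (mulIf (lt0r_neq0 e1)); rewrite -mulrA dE; ring.
  by rewrite ler_wpM2l.
have k0 : 0 <= k by apply: le_trans k1.
have h1 : 2 * q <= theta * k * q by rewrite ler_wpM2r.
have h2 : 12 * k <= theta * q * k by rewrite ler_wpM2r.
rewrite tE; nra.
Qed.

Lemma cvg_expR_oo (c : R) (u : nat -> nat) : 0 < c -> u i @[i --> \oo] --> \oo ->
  expR (- (c * (u i)%:R)) @[i --> \oo] --> (0 : R).
Proof.
move=> c0 u_oo.
have -> : (fun i => expR (- (c * (u i)%:R))) = (fun j => expR (- c) ^+ j) \o u.
  by apply/funext => i /=; rewrite -expRM_natl mulrN mulrC.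
apply: cvg_comp u_oo _; apply: cvg_expr.
by rewrite ger0_norm ?expR_ge0 // expR_lt1 oppr_lt0.
Qed.

End Exponents.

Theorem theorem6p10 (R : realType)
  (disp : nat -> measure_display) (T : forall d, measurableType (disp d))
  (P : forall d, probability (T d) R)
  (n k : nat -> nat)
  (xi : forall d, 'I_(n d).-1 -> {RV (P d) >-> borel_rV R d})
  (n_gt : \forall d \near \oo, (d < n d)%N)
  (xi_exch : \forall d \near \oo, exchangeable (xi d))
  (xi_gp : \forall d \near \oo, general_position (xi d))
  (k_oo : k d @[d --> \oo] --> \oo)
  (k_small : ((k d)%:R / d%:R : R) @[d --> \oo] --> (0 : R)) :
  ((exists2 eps : R, 0 < eps &
      \forall d \near \oo,
        (n d)%:R <= (k d)%:R * expR ((1 - eps) * d%:R / (k d)%:R)) ->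
   ('E_(P d)[fun w => (nfaces (k d).-1 (walk_hull (xi d) w))%:R]
      / ('C(n d, k d)%:R)%:E)%E @[d --> \oo] --> 1%E) /\
  ((exists2 eps : R, 0 < eps &
      \forall d \near \oo,
        (n d)%:R >= (k d)%:R * expR ((1 + eps) * d%:R / (k d)%:R)) ->
   ('E_(P d)[fun w => (nfaces (k d).-1 (walk_hull (xi d) w))%:R]
      / ('C(n d, k d)%:R)%:E)%E @[d --> \oo] --> 0%E).
Proof.
pose bounds d := exists e : R,
  [/\ ((0 < k d)%N /\ (k d <= d < n d)%N),
    ('E_(P d)[fun w => (nfaces (k d).-1 (walk_hull (xi d) w))%:R]
      / ('C(n d, k d)%:R)%:E)%E = e%:E,
    0 <= e <= 1,
    forall delta : R, 0 <= delta ->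
      1 - e <= expR (delta * ((k d)%:R + (k d)%:R * ln ((n d)%:R / (k d)%:R))
                     - d%:R * ln (1 + delta))
  & forall t : R, 0 < t <= 1 -> (2 * k d <= n d)%N ->
      e <= expR (ln ((n d)%:R / (k d)%:R) * (1 - (1 - t) * (k d)%:R)
                 + 4 * (k d)%:R + d.+1%:R * (t^-1 - 1))].
have ratio : \forall d \near \oo, bounds d.
  have k1 : \forall d \near \oo, (0 < k d)%N by move/cvgnyPgt: k_oo; exact.
  have kd : \forall d \near \oo, (k d)%:R / d%:R < 1 :> R by exact: (@cvgr_lt _ _ _ _ _ _ k_small _ ltr01).
  near=> d.
  have ngt : (d < n d)%N by near: d.
  have kpos : (0 < k d)%N by near: d.
  have kled : (k d <= d)%N.
    have : (k d)%:R / d%:R < 1 :> R by near: d.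
    have d0 : (0 < d)%N by near: d; exact: nbhs_infty_gt.
    by rewrite ltr_pdivrMr ?ltr0n // mul1r ltr_nat => /ltnW.
  have dm : (d <= (n d).-1)%N by rewrite -ltnS prednK // (leq_ltn_trans _ ngt).
  have ex : exchangeable (xi d) by near: d.
  have gp : general_position (xi d) by near: d.
  have nE : (n d).-1.+1 = n d by rewrite prednK // (leq_ltn_trans _ ngt).
  have kd' : (0 < k d <= d)%N by rewrite kpos.
  have := face_ratio_bounds ex gp dm kd'; rewrite nE => -[e [eE e01 few many]].
  exists (e / 'C(n d, k d)%:R); split=> //; first by rewrite kled.
  rewrite eE inver ifF //; apply/negbTE.
  by rewrite pnatr_eq0 -lt0n bin_gt0 (leq_trans kled) // ltnW.
split=> -[eps e0 hn].
  have kq : \forall d \near \oo, (k d)%:R / d%:R < eps / 4 :> R.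
    by apply: (@cvgr_lt _ _ _ _ _ _ k_small); rewrite divr_gt0.
  apply: (@squeeze_cvge _ _ _ _
    (fun d => (1 - expR (- (eps ^+ 2 / 8 * d%:R)))%:E) _ (fun=> 1%E)).
  - near=> d.
    have [e [[k0 /andP[kd kn]] -> /andP[e_ge0 e_le1] few _]] : bounds d by near: d.
    rewrite !lee_fin e_le1 andbT lerBlDl -lerBlDr.
    have k0' : (0 : R) < (k d)%:R by rewrite ltr0n.
    have d0' : (0 : R) < d%:R by rewrite ltr0n (leq_trans k0).
    have n0' : (0 : R) < (n d)%:R by rewrite ltr0n (leq_trans _ kn).
    have x0 : 0 <= eps / 2 by rewrite divr_ge0 // ltW.
    apply: le_trans (few _ x0) _.
    rewrite ler_expR; apply: exponent_few => //.
      rewrite mulrC -ler_pdivlMr //.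
      rewrite -ler_expR lnK ?posrE ?divr_gt0 // ler_pdivrMr // [leRHS]mulrC.
      by near: d.
    rewrite -ler_pdivrMr // ltW //; near: d; exact: kq.
  - apply: cvg_EFin; first by near=> d.
    rewrite -[X in _ --> X]subr0; apply: cvgB; first exact: cvg_cst.
    by apply: (@cvg_expR_oo _ _ id); [rewrite divr_gt0 ?exprn_gt0|exact: cvg_id].
  - exact: cvg_cst.
(* [theta k >= 2] because [k] tends to infinity, and [theta q >= 12] because
   [q >= d / k] does. *)
pose delta := eps / (2 * (1 + eps)); pose theta := delta * (eps / (2 + eps)).
have e1 : 0 < 1 + eps by rewrite ltr_pwDl // ltW.
have delta0 : 0 < delta by rewrite divr_gt0 // mulr_gt0.
have delta1 : delta < 1 by rewrite ltr_pdivrMr ?mulr_gt0 // mul1r; lra.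
have theta0 : 0 < theta by rewrite mulr_gt0 // divr_gt0 // ltr_pwDl // ltW.
have kq : \forall d \near \oo, (k d)%:R / d%:R < theta / 12 :> R.
  by apply: (@cvgr_lt _ _ _ _ _ _ k_small); rewrite divr_gt0.
have kbig : \forall d \near \oo, (Num.truncn (2 / theta) < k d)%N.
  by move/cvgnyPgt: k_oo; exact.
apply: (@squeeze_cvge _ _ _ _ (fun=> 0%E) _ (fun d => (expR (- (1 * (k d)%:R)))%:E)).
- near=> d.
  have [e [[k0 /andP[kd kn]] -> /andP[e_ge0 e_le1] _ many]] : bounds d by near: d.
  rewrite !lee_fin e_ge0 /=.
  have k0' : (0 : R) < (k d)%:R by rewrite ltr0n.
  have d0' : (0 : R) < d%:R by rewrite ltr0n (leq_trans k0).
  have n0' : (0 : R) < (n d)%:R by rewrite ltr0n (leq_trans _ kn).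
  have nk : (k d)%:R * expR ((1 + eps) * d%:R / (k d)%:R) <= (n d)%:R by near: d.
  set q := ln ((n d)%:R / (k d)%:R) in many.
  have q_ge : (1 + eps) * d%:R / (k d)%:R <= q.
    by rewrite -ler_expR lnK ?posrE ?divr_gt0 // ler_pdivlMr // mulrC.
  have dq : (1 + eps) * d%:R <= (k d)%:R * q by rewrite [leRHS]mulrC -ler_pdivrMr.
  have n2k : (2 * k d <= n d)%N.
    rewrite -(ler_nat R) natrM; apply: le_trans nk.
    have := expR_ge1Dx ((1 + eps) * d%:R / (k d)%:R).
    rewrite -(ler_pM2l k0') mulrDr mulr1 [_ * (_ / _)]mulrC divfK ?gt_eqF //.
    have : (k d)%:R <= d%:R :> R by rewrite ler_nat.
    have : 0 <= eps * d%:R by rewrite mulr_ge0 ?ltW.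
    set E := expR _; lra.
  have q0 : 0 <= q by apply: le_trans q_ge; rewrite divr_ge0 ?mulr_ge0 ?ltW.
  have t01 : 0 < 1 - delta <= 1 by rewrite subr_gt0 delta1 /= gerBl ltW.
  apply: le_trans (many _ t01 n2k) _.
  have dE : 1 - (1 - delta) = delta by ring.
  rewrite ler_expR dE -[d.+1%:R]natr1 [1 * _]mul1r.
  apply: exponent_many => //.
  - by rewrite ler1n.
  - rewrite -/delta -/theta mulrC -ler_pdivrMr //.
    have : (Num.truncn (2 / theta) < k d)%N by near: d.
    rewrite -(ler_nat R) => /(le_trans _); apply; exact/ltW/truncnS_gt.
  - rewrite -/delta -/theta mulrC -ler_pdivrMr //; apply: le_trans q_ge.
    have : (k d)%:R / d%:R < theta / 12 :> R by near: d.
    rewrite ltr_pdivrMr // => h.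
    rewrite ler_pdivrMr // [leRHS]mulrAC ler_pdivlMr //.
    have : 0 <= eps * d%:R * theta.
      by apply: mulr_ge0; [apply: mulr_ge0 (ltW e0) _ | exact: ltW].
    by move: h; lra.
- exact: cvg_cst.
- apply: cvg_EFin; first by near=> d.
  exact: cvg_expR_oo.
Unshelve. all: by end_near. Qed.
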